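(* The map $D:\mathcal{S}\rightarrow\mathcal{D}$, from the algebra of symmetric functions to the algebra of doubly symmetric functions, given by $D(S_\lambda)=\sum_{\mu\subseteq\lambda}S_\mu S_{(\lambda/\mu)'}$ and linearity, is surjective, and its kernel is the ideal $\mathcal{I}$ of $\mathcal{S}$ generated by all differences $S_\lambda-S_{\lambda'}$, $\lambda$ a partition.
   Context: $\mathcal{S}$ is the algebra of symmetric functions over $\mathbb{Q}$, with basis the Schur functions $S_\lambda$ indexed by all partitions $\lambda$ (including the empty one); $\lambda'$ is the conjugate partition. $S_{(\lambda/\mu)'}$ is the skew Schur function of the conjugate skew shape $(\lambda/\mu)'=\lambda'/\mu'$. The linear map $D$ is known to take values in $\mathcal{D}$. Hook Schur functions: for finite, possibly empty, lists of variables $X=(x_1,\ldots,x_k)$, $Y=(y_1,\ldots,y_\ell)$, a $(k,\ell)$-semistandard tableau of shape $\lambda$ is a filling of the Young diagram of $\lambda$ with entries from the ordered alphabet $1<2<\cdots<k<1'<\cdots<\ell'$ such that entries are non-decreasing in each row and each column, unprimed symbols may repeat in rows but not in columns, and primed symbols may repeat in columns but not in rows. Then $HS_\lambda(X;Y)=\sum_T x^T$, summed over all such tableaux $T$, where $x^T=\prod_j x_j^{\#\{j \text{ in } T\}}\prod_j y_j^{\#\{j'\text{ in }T\}}$. A symmetric function $\sum_\lambda m_\lambda S_\lambda$ is doubly symmetric if for all finite (possibly empty) sets of variables $X,Y$ one has $\sum_\lambda m_\lambda S_\lambda(X,Y)=\sum_\lambda m_\lambda HS_\lambda(X;Y)$,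 where $S_\lambda(X,Y)$ is the Schur polynomial in all the variables of $X$ and $Y$ together. $\mathcal{D}\subseteq\mathcal{S}$ is the set of all doubly symmetric functions. *)

(* Defs.v *)
From HB Require Import structures.
From mathcomp Require Import all_boot all_order all_algebra all_fingroup.
From mathcomp Require Import finmap mpoly boolp.
From mathcomp Require Import zify.

Set Implicit Arguments.
Unset Strict Implicit.
Unset Printing Implicit Defensive.

Import GRing.Theory.

Record intpart := IntPart {
  pval :> seq nat;
  pvalP : sorted geq pval && (0 \notin pval) }.

HB.instance Definition _ := [isSub for pval].
HB.instance Definition _ := [Choice of intpart by <:].

Fact empty_part_subproof : sorted geq [::] && (0 \notin [::]).
Proof. by []. Qed.
Definition empty_part : intpart := IntPart empty_part_subproof.

Lemma part_geq (la : intpart) i j : i <= j -> nth 0 la j <= nth 0 la i.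
Proof.
move=> lij; have /andP[srt _] := pvalP la.
have [lj|/(nth_default 0) -> //] := ltnP j (size la).
have geq_tr : transitive geq by move=> a b c /= h1 h2; apply: leq_trans h2 h1.
by apply: (sorted_leq_nth geq_tr leqnn) => //; rewrite inE /= ?(leq_ltn_trans lij lj).
Qed.

Lemma part_gt0 (la : intpart) i : i < size la -> 0 < nth 0 la i.
Proof.
move=> li; have /andP[_ n0] := pvalP la.
by rewrite lt0n; apply: contraNneq n0 => <-; apply: mem_nth.
Qed.

Definition conj_seq (s : seq nat) : seq nat :=
  [seq count (fun p => j < p) s | j <- iota 0 (head 0 s)].

Fact conj_subproof (la : intpart) :
  sorted geq (conj_seq la) && (0 \notin conj_seq la).
Proof.
apply/andP; split.
  apply: (homo_sorted (e := leq)); last exact: iota_sorted.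
  by move=> i j lij; apply: sub_count => p; apply: leq_ltn_trans.
apply/mapP => -[j]; rewrite mem_iota add0n /= => lj /esym/eqP.
by case: (pval la) lj => //= a s ->.
Qed.
Definition conj_part (la : intpart) : intpart := IntPart (conj_subproof la).

Definition included (mu la : seq nat) : bool :=
  [forall i : 'I_(size mu), nth 0 mu i <= nth 0 la i].

Fixpoint below (s : seq nat) : seq (seq nat) :=
  if s is a :: s' then [::] :: [seq b :: t | b <- iota 1 a, t <- below s']
  else [:: [::]].

(* The duplicate-free list of all partitions contained in la; see
   mem_subparts and subparts_uniq. *)
Definition subparts (la : intpart) : seq intpart := pmap insub (below la).

Lemma includedP (mu la : seq nat) :
  reflect (forall i, nth 0 mu i <= nth 0 la i) (included mu la).
Proof.
apply: (iffP forallP) => [h i|h i]; last exact: h.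
by have [li|/(nth_default 0) -> //] := ltnP i (size mu); apply: (h (Ordinal li)).
Qed.

Lemma mem_below (s t : seq nat) :
  (t \in below s) = (0 \notin t) && included t s.
Proof.
elim: s t => [|a s IH] [|b t]; rewrite ?inE ?eqxx //=.
- by symmetry; apply/includedP => -[].
- apply/esym/negP => /andP[+ /includedP/(_ 0)].
  by case: b.
- by symmetry; apply/includedP => -[].
- apply/allpairsP/andP => /= [[[b' t'] /= []]|[]].
    rewrite mem_iota IH => hb /andP[nt /includedP it] [-> ->]; split.
      by rewrite negb_or nt andbT; case: b' hb.
    by apply/includedP => -[|i]; [move: hb; rewrite /=; lia | exact: it].
  rewrite negb_or => /andP[nb nt] /includedP it; exists (b, t); split => //=.
    by rewrite mem_iota; have := it 0; case: b nb {it} => //= b _; lia.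
  by rewrite IH nt; apply/includedP => i; apply: (it i.+1).
Qed.

Lemma below_uniq (s : seq nat) : uniq (below s).
Proof.
elim: s => //= a s IH; rewrite allpairs_uniq ?iota_uniq // ?andbT.
  by apply/allpairsP => -[[b t] []].
by move=> [b t] [b' t'] _ _ /= [-> ->].
Qed.

Lemma mem_subparts (mu la : intpart) : (mu \in subparts la) = included mu la.
Proof.
rewrite mem_pmap_sub mem_below.
by have /andP[_ ->] := pvalP mu.
Qed.

Lemma subparts_uniq (la : intpart) : uniq (subparts la).
Proof. by apply: pmap_sub_uniq; apply: below_uniq. Qed.

Definition cell (la mu : seq nat) : predArgType :=
  {c : 'I_(size la) * 'I_(head 0 la) | nth 0 mu c.1 <= c.2 < nth 0 la c.1}.
HB.instance Definition _ (la mu : seq nat) := Finite.on (cell la mu).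

Definition cell_row la mu (c : cell la mu) : nat := (val c).1.
Definition cell_col la mu (c : cell la mu) : nat := (val c).2.

Definition ssyt n la mu (T : {ffun cell la mu -> 'I_n}) : bool :=
  [forall c, forall d,
     ((cell_row c == cell_row d) && (cell_col c < cell_col d) ==> (T c <= T d))
  && ((cell_col c == cell_col d) && (cell_row c < cell_row d) ==> (T c < T d))].

Definition skew_schur_poly (n : nat) (la mu : seq nat) : {mpoly rat[n]} :=
  (\sum_(T : {ffun cell la mu -> 'I_n} | ssyt T) \prod_c 'X_(T c))%R.

(* In the alphabet 'I_(k + l), the letters i < k are the unprimed ones (the
   variables of X) and the letters k <= i the primed ones (those of Y). *)
Definition hook_ssyt k l la (T : {ffun cell la [::] -> 'I_(k + l)}) : bool :=
  [forall c, forall d,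
     ((cell_row c == cell_row d) && (cell_col c < cell_col d) ==>
        (T c <= T d) && ((T c == T d) ==> (T c < k)))
  && ((cell_col c == cell_col d) && (cell_row c < cell_row d) ==>
        (T c <= T d) && ((T c == T d) ==> (k <= T c)))].

Definition hook_schur (k l : nat) (la : seq nat) : {mpoly rat[k + l]} :=
  (\sum_(T : {ffun cell la [::] -> 'I_(k + l)} | hook_ssyt T)
      \prod_c 'X_(T c))%R.

Local Open Scope ring_scope.

(* The substitution x_n := 0 for the last of the n.+1 variables. *)
Definition restrict_poly n (p : {mpoly rat[n.+1]}) : {mpoly rat[n]} :=
  p \mPo [tuple (if unlift ord_max i is Some j then 'X_j else 0) | i < n.+1].

(* The graded inverse limit of the rings of symmetric polynomials: families of
   bounded degree, compatible with setting the last variable to 0. *)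
Record symfun := SymFun {
  sfval :> forall n, {mpoly rat[n]};
  sf_sym : forall n, sfval n \is symmetric;
  sf_restrict : forall n, restrict_poly (sfval n.+1) = sfval n;
  sf_deg : exists d, forall n, (msize (sfval n) <= d)%N }.

Lemma symfunP (f g : symfun) : (forall n, f n = g n) -> f = g.
Proof.
case: f g => [f f1 f2 f3] [g g1 g2 g3] /= fg.
have {}fg : f = g by apply: functional_extensionality_dep.
by subst g; congr SymFun; apply: Prop_irrelevance.
Qed.

HB.instance Definition _ := gen_eqMixin symfun.
HB.instance Definition _ := gen_choiceMixin symfun.

Section SymfunRing.
Implicit Types (f g h : symfun) (a b : rat).

#[local] Obligation Tactic := idtac.

Program Definition sf_const a : symfun := @SymFun (fun n => a%:MP) _ _ _.
Next Obligation. by move=> a n; rewrite /= -alg_mpolyC rpredZ ?rpred1. Qed.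
Next Obligation. by move=> a n; rewrite /restrict_poly comp_mpolyC. Qed.
Next Obligation. by move=> a; exists 1%N => n; rewrite msizeC; case: eqP. Qed.

Program Definition sf_add f g : symfun := @SymFun (fun n => f n + g n) _ _ _.
Next Obligation. by move=> f g n; rewrite rpredD ?sf_sym. Qed.
Next Obligation.
by move=> f g n; rewrite /restrict_poly comp_mpolyD; congr (_ + _); apply: sf_restrict.
Qed.
Next Obligation.
move=> f g; have [d hd] := sf_deg f; have [e he] := sf_deg g.
exists (maxn d e) => n; apply: leq_trans (msizeD_le _ _) _.
by rewrite geq_max !leq_max hd he orbT.
Qed.

Program Definition sf_opp f : symfun := @SymFun (fun n => - f n) _ _ _.
Next Obligation. by move=> f n; rewrite rpredN ?sf_sym. Qed.
Next Obligation.
by move=> f n; rewrite /restrict_poly comp_mpolyN; congr (- _); apply: sf_restrict.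
Qed.
Next Obligation.
by move=> f; have [d hd] := sf_deg f; exists d => n; rewrite msizeN.
Qed.

Program Definition sf_mul f g : symfun := @SymFun (fun n => f n * g n) _ _ _.
Next Obligation. by move=> f g n; rewrite rpredM ?sf_sym. Qed.
Next Obligation.
by move=> f g n; rewrite /restrict_poly rmorphM; congr (_ * _); apply: sf_restrict.
Qed.
Next Obligation.
move=> f g; have [d hd] := sf_deg f; have [e he] := sf_deg g.
exists (d + e)%N => n.
have [->|f0] := eqVneq (f n) 0; first by rewrite mul0r msize0.
have [->|g0] := eqVneq (g n) 0; first by rewrite mulr0 msize0.
by rewrite msizeM // (leq_trans (leq_pred _)) // leq_add.
Qed.

Program Definition sf_scale a f : symfun := @SymFun (fun n => a *: f n) _ _ _.
Next Obligation. by move=> a f n; rewrite rpredZ ?sf_sym. Qed.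
Next Obligation.
by move=> a f n; rewrite /restrict_poly comp_mpolyZ; congr (_ *: _); apply: sf_restrict.
Qed.
Next Obligation.
move=> a f; have [d hd] := sf_deg f; exists d => n.
by apply: leq_trans (msizeZ_le _ _) _.
Qed.


Let addA : associative sf_add.
Proof. by move=> f g h; apply: symfunP => n; apply: addrA. Qed.
Let addC : commutative sf_add.
Proof. by move=> f g; apply: symfunP => n; apply: addrC. Qed.
Let add0 : left_id (sf_const 0) sf_add.
Proof. by move=> f; apply: symfunP => n; rewrite /= mpolyC0 add0r. Qed.
Let addN : left_inverse (sf_const 0) sf_opp sf_add.
Proof. by move=> f; apply: symfunP => n; rewrite /= mpolyC0 addNr. Qed.
HB.instance Definition _ := GRing.isZmodule.Build symfun addA addC add0 addN.

Let mulA : associative sf_mul.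
Proof. by move=> f g h; apply: symfunP => n; apply: mulrA. Qed.
Let mulC : commutative sf_mul.
Proof. by move=> f g; apply: symfunP => n; apply: mulrC. Qed.
Let mul1 : left_id (sf_const 1) sf_mul.
Proof. by move=> f; apply: symfunP => n; rewrite /= mul1r. Qed.
Let mulD : left_distributive sf_mul sf_add.
Proof. by move=> f g h; apply: symfunP => n; apply: mulrDl. Qed.
Let one_neq0 : sf_const 1 != 0.
Proof.
apply/eqP => /(congr1 (fun f : symfun => f 0%N)) /= /eqP.
by rewrite mpolyC0 oner_eq0.
Qed.
HB.instance Definition _ :=
  GRing.Zmodule_isComNzRing.Build symfun mulA mulC mul1 mulD one_neq0.

Let scaleA a b f : sf_scale a (sf_scale b f) = sf_scale (a * b) f.
Proof. by apply: symfunP => n; apply: scalerA. Qed.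
Let scale1 : left_id 1 sf_scale.
Proof. by move=> f; apply: symfunP => n; apply: scale1r. Qed.
Let scaleDr : right_distributive sf_scale +%R.
Proof. by move=> a f g; apply: symfunP => n; apply: scalerDr. Qed.
Let scaleDl f : {morph sf_scale^~ f : a b / a + b}.
Proof. by move=> a b; apply: symfunP => n; apply: scalerDl. Qed.
HB.instance Definition _ :=
  GRing.Zmodule_isLmodule.Build rat symfun scaleA scale1 scaleDr scaleDl.

Let scaleAl a f g : a *: (f * g) = a *: f * g.
Proof. by apply: symfunP => n; apply: scalerAl. Qed.
HB.instance Definition _ := GRing.Lmodule_isLalgebra.Build rat symfun scaleAl.
HB.instance Definition _ := GRing.Lalgebra_isComAlgebra.Build rat symfun.

Lemma sf_addE f g n : (f + g) n = f n + g n. Proof. by []. Qed.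
Lemma sf_mulE f g n : (f * g) n = f n * g n. Proof. by []. Qed.
Lemma sf_scaleE a f n : (a *: f) n = a *: f n. Proof. by []. Qed.

End SymfunRing.

Section BenderKnuth.
Local Open Scope nat_scope.
Variables (la mu : intpart) (n : nat).
Local Notation cell := (cell la mu).
Local Notation row := (@cell_row la mu).
Local Notation col := (@cell_col la mu).
Local Notation tab := {ffun cell -> 'I_n}.
Implicit Types (c d : cell) (T U : tab) (f g : nat -> nat).

Lemma cell_bounds c : nth 0 mu (row c) <= col c < nth 0 la (row c).
Proof. exact: (valP c). Qed.

Lemma cell_exists r j :
  nth 0 mu r <= j < nth 0 la r -> exists c, row c = r /\ col c = j.
Proof.
move=> h; have /andP[_ h2] := h.
have rl : r < size la.
  by rewrite ltnNge; apply/negP => /(nth_default 0) e; rewrite e in h2.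
have jl : j < head 0 la.
  by rewrite -nth0; apply: leq_trans h2 _; apply: part_geq.
by exists (exist _ (Ordinal rl, Ordinal jl) h).
Qed.

Lemma cell_inj c d : row c = row d -> col c = col d -> c = d.
Proof.
move=> h1 h2; apply: val_inj.
by case: c d h1 h2 => [[a b] h] [[a' b'] h'];
   rewrite /cell_row /cell_col /= => /val_inj -> /val_inj ->.
Qed.

Lemma ssytP T :
  reflect ((forall c d, row c = row d -> col c < col d -> T c <= T d) /\
           (forall c d, col c = col d -> row c < row d -> T c < T d)) (ssyt T).
Proof.
apply: (iffP forallP) => [h|[h1 h2] c].
  by split=> c d e l; have /forallP/(_ d)/andP[] := h c; rewrite e eqxx l //=.
apply/forallP => d; apply/andP; split; apply/implyP => /andP[/eqP e l].
  exact: h1.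
exact: h2.
Qed.

Definition base r := minn (nth 0 mu r) (nth 0 la r).
Definition bounded f := forall r, base r <= f r <= nth 0 la r.

Lemma row_cellP f r : bounded f -> f r < nth 0 la r ->
  exists c, row c = r /\ col c = f r.
Proof. by move=> /(_ r); rewrite /base => h1 h2; apply: cell_exists; lia. Qed.

Lemma bounded_le f g r : bounded f -> bounded g ->
  (forall c, row c = r -> col c < g r -> col c < f r) -> g r <= f r.
Proof.
move=> bf bg h; rewrite leqNgt; apply/negP => l.
have [|c [cr cc]] := row_cellP (r := r) bf; first by have := bg r; lia.
by have := h c cr; rewrite cc l ltnn => /(_ isT).
Qed.

Lemma card_row f g r : base r <= f r -> f r <= g r -> g r <= nth 0 la r ->
  #|[pred c | (row c == r) && (f r <= col c < g r)]| = g r - f r.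
Proof.
move=> h1 h2 h3; rewrite -(size_iota (f r) (g r - f r)) cardE -(size_map col).
apply: perm_size; apply: uniq_perm; rewrite ?iota_uniq //.
  rewrite map_inj_in_uniq ?enum_uniq // => c d; rewrite !mem_enum !inE.
  by move=> /andP[/eqP r1 _] /andP[/eqP r2 _]; apply: cell_inj; rewrite r1 r2.
move=> j; rewrite mem_iota subnKC //; apply/mapP/idP => [[c]|l].
  by rewrite mem_enum inE => /andP[_ h] ->.
have [|c [cr cc]] := @cell_exists r j; first by move: h1; rewrite /base; lia.
by exists c => //; rewrite mem_enum inE cr eqxx cc.
Qed.

Lemma card_between f g : bounded f -> bounded g -> (forall r, f r <= g r) ->
  #|[pred c | f (row c) <= col c < g (row c)]| = \sum_(r < size la) (g r - f r).
Proof.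
move=> bf bg fg; rewrite -sum1_card (partition_big (fun c => (val c).1) predT) //=.
apply: eq_bigr => r _; rewrite -(@card_row f g r) ?fg //; first last.
- by have /andP[] := bg r.
- by have /andP[] := bf r.
rewrite -sum1_card; apply: eq_bigl => c; rewrite !inE andbC -val_eqE /=.
by rewrite /cell_row; case: eqP => [->|].
Qed.

(* In row r of T, the entries smaller than m are those in columns < bnd T m r. *)
Definition bnd T m r :=
  maxn (base r) (\max_(c | (row c == r) && (T c < m)) (col c).+1).

Lemma bnd_bounded T m : bounded (bnd T m).
Proof.
move=> r; rewrite leq_maxl geq_max geq_minr /=.
by apply/bigmax_leqP => c /andP[/eqP <- _]; have /andP[] := cell_bounds c.
Qed.

Lemma bndP T m c : ssyt T -> (T c < m) = (col c < bnd T m (row c)).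
Proof.
move=> /ssytP[hr _]; apply/idP/idP => h.
  by rewrite leq_max (bigmax_sup c) ?orbT // eqxx.
rewrite ltnNge; apply: contraL h => h; rewrite -leqNgt geq_max.
have := cell_bounds c; rewrite /base => cb; apply/andP; split; first lia.
apply/bigmax_leqP => d /andP[/eqP dr dm]; rewrite ltnNge leq_eqVlt.
apply/negP => /orP[/eqP e|l].
  by move: dm; rewrite -(@cell_inj c d) // ltnNge h.
by have := hr c d (esym dr) l; lia.
Qed.

Lemma bnd_uniq T m f : ssyt T -> bounded f ->
  (forall c, (T c < m) = (col c < f (row c))) -> bnd T m =1 f.
Proof.
move=> sT bf h r; have bb := bnd_bounded T m.
by apply/eqP; rewrite eqn_leq; apply/andP; split; apply: bounded_le => // c <-;
   rewrite -bndP // h.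
Qed.

Lemma bnd_mono T m m' r : ssyt T -> m <= m' -> bnd T m r <= bnd T m' r.
Proof.
move=> sT mm; apply: bounded_le; try exact: bnd_bounded.
by move=> c <-; rewrite -!bndP // => /leq_trans; apply.
Qed.

Lemma bnd_lace T m r s : ssyt T -> r < s -> bnd T m.+1 s <= bnd T m r.
Proof.
move=> sT rs; rewrite leqNgt; apply/negP => l.
have /andP[b1 b2] := bnd_bounded T m r.
have /andP[b3 b4] := bnd_bounded T m.+1 s.
have lrs := part_geq la (ltnW rs); have mrs := part_geq mu (ltnW rs).
have [|c [cr cc]] := row_cellP (r := r) (bnd_bounded T m); first lia.
have [|d [dr dc]] := @cell_exists s (bnd T m r).
  by move: b1; rewrite /base; lia.
have /ssytP[_ /(_ c d)] := sT; rewrite cc dc cr dr => /(_ erefl rs) cd.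
have := bndP m.+1 d sT; rewrite dr dc l => dm.
by have := bndP m c sT; rewrite cr cc ltnn; lia.
Qed.

Lemma ssyt_bnd U (e : nat -> nat -> nat) :
  (forall m c, (U c < m) = (col c < e m (row c))) ->
  (forall m r s, r < s -> e m.+1 s <= e m r) -> ssyt U.
Proof.
move=> he hl; apply/ssytP; split=> c d.
  by move=> rcd l; rewrite -ltnS he rcd (ltn_trans l) // -he.
move=> ccd l; rewrite he ccd; apply: leq_trans (hl _ _ _ l).
by rewrite -he.
Qed.

Section Swap.
Variables (p q : 'I_n).
Hypothesis pq : q = p.+1 :> nat.

Definition bk_hi T r :=
  if r is r'.+1 then minn (bnd T p.+2 r) (bnd T p r') else bnd T p.+2 0.
Definition bk_lo T r := maxn (bnd T p r) (bnd T p.+2 r.+1).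
Definition bk_bnd T r := bk_hi T r + bk_lo T r - bnd T p.+1 r.
(* The Bender-Knuth involution exchanging the numbers of p's and q's in T: the
   boundary bnd T q of each row is reflected inside [bk_lo T, bk_hi T]. *)
Definition bk T : tab :=
  [ffun c => if (p <= T c) && (T c < p.+2)
             then (if col c < bk_bnd T (row c) then p else q) else T c].

Lemma bk_between T r : ssyt T -> bk_lo T r <= bnd T p.+1 r <= bk_hi T r.
Proof.
move=> sT; rewrite geq_max bnd_mono // bnd_lace //=.
by case: r => [|r] /=; rewrite ?leq_min bnd_mono // bnd_lace.
Qed.

Lemma bk_between' T r : ssyt T -> bk_lo T r <= bk_bnd T r <= bk_hi T r.
Proof. by move=> /(bk_between r); rewrite /bk_bnd; lia. Qed.

Lemma bk_lo_ge T r : bnd T p r <= bk_lo T r.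
Proof. exact: leq_maxl. Qed.
Lemma bk_hi_le T r : bk_hi T r <= bnd T p.+2 r.
Proof. by case: r => //= r; apply: geq_minl. Qed.

Lemma bk_le T r : ssyt T -> bnd T p r <= bk_bnd T r <= bnd T p.+2 r.
Proof.
move=> /(bk_between' r) /andP[h1 h2].
by rewrite (leq_trans (bk_lo_ge T r) h1) (leq_trans h2 (bk_hi_le T r)).
Qed.

Lemma bk_bounded T : ssyt T -> bounded (bk_bnd T).
Proof.
move=> sT r; have := bk_le r sT.
by have := bnd_bounded T p r; have := bnd_bounded T p.+2 r; lia.
Qed.

Definition bk_thr T m := if m == p.+1 then bk_bnd T else bnd T m.

Lemma bk_thrP T m c : ssyt T -> (bk T c < m) = (col c < bk_thr T m (row c)).
Proof.
move=> sT; rewrite ffunE /bk_thr.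
have h := bk_le (row c) sT; have h1 := bndP p c sT; have h2 := bndP p.+2 c sT.
case: (eqVneq m p.+1) => [->|mp].
  case: ifP => [_|]; first by case: ifP => /= _; rewrite ?pq; lia.
  by move=> h3; lia.
rewrite -bndP //; case: ifP => // /andP[h3 h4].
by case: ifP => _; rewrite ?pq; lia.
Qed.

Lemma bk_ssyt T : ssyt T -> ssyt (bk T).
Proof.
move=> sT; apply: (ssyt_bnd (e := bk_thr T)) => [m c|m r s rs].
  exact: bk_thrP.
rewrite /bk_thr eqSS; case: (eqVneq m p) => [->|mp].
  have -> : (p : nat) == p.+1 = false by lia.
  have /andP[_ h] := bk_between' s sT; apply: leq_trans h _.
  case: s rs => // s rs /=; apply: leq_trans (geq_minr _ _) _.
  move: rs; rewrite ltnS leq_eqVlt => /orP[/eqP -> //|l].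
  by apply: leq_trans (bnd_lace _ sT l); apply: bnd_mono.
case: (eqVneq m p.+1) => [->|_]; last exact: bnd_lace.
have /andP[h _] := bk_between' r sT; apply: leq_trans h.
apply: leq_trans (leq_maxr _ _).
move: rs; rewrite leq_eqVlt => /orP[/eqP -> //|l].
by apply: leq_trans (bnd_lace p.+2 sT l); apply: bnd_mono.
Qed.

Lemma bnd_bk T m : ssyt T -> bnd (bk T) m =1 bk_thr T m.
Proof.
move=> sT; apply: bnd_uniq; first exact: bk_ssyt.
  by rewrite /bk_thr; case: ifP => _; [apply: bk_bounded | apply: bnd_bounded].
by move=> c; apply: bk_thrP.
Qed.

Lemma bk_bndK T r : ssyt T -> bk_bnd (bk T) r = bnd T p.+1 r.
Proof.
move=> sT; have E0 r' : bnd (bk T) p r' = bnd T p r'.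
  by rewrite bnd_bk // /bk_thr (_ : (_ == _) = false) //; lia.
have E2 r' : bnd (bk T) p.+2 r' = bnd T p.+2 r'.
  by rewrite bnd_bk // /bk_thr (_ : (_ == _) = false) //; lia.
have := bk_between r sT; rewrite {1}/bk_bnd bnd_bk // /bk_thr eqxx.
have -> : bk_lo (bk T) r = bk_lo T r by rewrite /bk_lo E0 E2.
have -> : bk_hi (bk T) r = bk_hi T r by rewrite /bk_hi; case: r => *; rewrite ?E0 ?E2.
by rewrite /bk_bnd; lia.
Qed.

Lemma bkK T : ssyt T -> bk (bk T) = T.
Proof.
move=> sT; apply/ffunP => c; rewrite ffunE bk_bndK // -bndP //.
have -> : (p <= bk T c) && (bk T c < p.+2) = (p <= T c) && (T c < p.+2).
  by rewrite ffunE; case: ifP => // h; case: ifP => _; rewrite ?pq; lia.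
case: ifP => [h|h]; last by rewrite ffunE h.
by apply: val_inj; case: ifP => /=; rewrite ?pq; lia.
Qed.

Local Arguments bk_hi : simpl never.

Lemma bk_sum T : ssyt T ->
  \sum_(r < size la) (bk_hi T r + bk_lo T r)
  = \sum_(r < size la) (bnd T p.+2 r + bnd T p r).
Proof.
move=> sT.
have H N : \sum_(r < N) (bk_hi T r + bk_lo T r) + bk_hi T N
  = \sum_(r < N) (bnd T p.+2 r + bnd T p r) + bnd T p.+2 N.
  elim: N => [|N IH]; first by rewrite !big_ord0.
  have hiS : bk_hi T N.+1 = minn (bnd T p.+2 N.+1) (bnd T p N) by [].
  have loE : bk_lo T N = maxn (bnd T p N) (bnd T p.+2 N.+1) by [].
  rewrite !big_ord_recr /= hiS loE; move: IH.
  move: (\sum_(r < N) _) (\sum_(r < N) _) (bk_hi T N) (bnd T p.+2 N).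
  by move: (bnd T p N) (bnd T p.+2 N.+1); lia.
have := H (size la).
have z : bnd T p.+2 (size la) = 0.
  have /andP[_] := bnd_bounded T p.+2 (size la).
  by rewrite nth_default // leqn0 => /eqP.
by have := bk_hi_le T (size la); rewrite z; lia.
Qed.

Lemma card_bk T : ssyt T ->
  (#|[pred c | bk T c == p]| = #|[pred c | T c == q]|) *
  (#|[pred c | bk T c == q]| = #|[pred c | T c == p]|).
Proof.
move=> sT.
have E U m (r : 'I_n) : r = m :> nat -> ssyt U ->
    #|[pred c | U c == r]| = \sum_(i < size la) (bnd U m.+1 i - bnd U m i).
  move=> rm sU; rewrite -card_between; try exact: bnd_bounded; last first.
    by move=> i; apply: bnd_mono.
  by apply: eq_card => c; rewrite !inE leqNgt -!bndP // -val_eqE /= rm; lia.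
have sB := bk_ssyt sT.
rewrite !(E _ _ q pq) // !(E _ _ p erefl) //.
have Eb m r : bnd (bk T) m r = bk_thr T m r by exact: bnd_bk.
have bk_b r : bnd (bk T) p.+1 r = bk_bnd T r by rewrite Eb /bk_thr eqxx.
have bk_a r : bnd (bk T) p r = bnd T p r by rewrite Eb /bk_thr ltn_eqF.
have bk_c r : bnd (bk T) p.+2 r = bnd T p.+2 r by rewrite Eb /bk_thr gtn_eqF.
have ab r : bnd T p r <= bnd T p.+1 r by apply: bnd_mono.
have bc r : bnd T p.+1 r <= bnd T p.+2 r by apply: bnd_mono.
have h r := bk_le r sT; have h' r := bk_between r sT.
have S := bk_sum sT; rewrite [RHS]big_split /= in S.
have Sb : \sum_(r < size la) bk_bnd T r + \sum_(r < size la) bnd T p.+1 r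
    = \sum_(r < size la) (bk_hi T r + bk_lo T r).
  rewrite -big_split /=; apply: eq_bigr => r _; have := h' r.
  by rewrite /bk_bnd; lia.
have Sab : \sum_(r < size la) bnd T p r <= \sum_(r < size la) bnd T p.+1 r.
  by apply: leq_sum.
have Sbc : \sum_(r < size la) bnd T p.+1 r <= \sum_(r < size la) bnd T p.+2 r.
  by apply: leq_sum.
have lea r : bnd T p r <= bk_bnd T r by have /andP[] := h r.
have lec r : bk_bnd T r <= bnd T p.+2 r by have /andP[] := h r.
have sub (F G : nat -> nat) : (forall r, G r <= F r) ->
    \sum_(r < size la) (F r - G r) = \sum_(r < size la) F r - \sum_(r < size la) G r.
  by move=> GF; rewrite sumnB.
split.
  under eq_bigr do rewrite bk_a bk_b.
  rewrite (sub _ _ lea) (sub _ _ bc); move: Sb S Sab Sbc.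
  move: (\sum_(r < size la) bk_bnd T r) (\sum_(r < size la) bnd T p r)
    (\sum_(r < size la) bnd T p.+1 r) (\sum_(r < size la) bnd T p.+2 r)
    (\sum_(r < size la) (bk_hi T r + bk_lo T r)).
  by clear; lia.
under eq_bigr do rewrite bk_b bk_c.
rewrite (sub _ _ lec) (sub _ _ ab); move: Sb S Sab Sbc.
move: (\sum_(r < size la) bk_bnd T r) (\sum_(r < size la) bnd T p r)
  (\sum_(r < size la) bnd T p.+1 r) (\sum_(r < size la) bnd T p.+2 r)
  (\sum_(r < size la) (bk_hi T r + bk_lo T r)).
by clear; lia.
Qed.

Lemma prod_card (f : cell -> 'I_n) :
  (\prod_c 'X_(f c) = \prod_j 'X_j ^+ #|[pred c | f c == j]| :> {mpoly rat[n]})%R.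
Proof.
rewrite (partition_big f predT) //=; apply: eq_bigr => j _.
rewrite (eq_bigr (fun=> 'X_j)%R) => [|c /eqP -> //].
by rewrite -prodr_const; apply: eq_bigl => c; rewrite inE.
Qed.

Lemma prod_bk T : ssyt T ->
  (\prod_c 'X_(tperm p q (bk T c)) = \prod_c 'X_(T c) :> {mpoly rat[n]})%R.
Proof.
move=> sT; rewrite !prod_card; apply: eq_bigr => j _; congr (_ ^+ _)%R.
have [H1 H2] := card_bk sT.
transitivity #|[pred c | bk T c == tperm p q j]|.
  by apply: eq_card => c; rewrite !inE (can2_eq (tpermK p q) (tpermK p q)).
case: tpermP => [->|->|jp jq] //.
apply: eq_card => c; rewrite !inE ffunE.
case: ifP => // h; have -> : (T c == j) = false.
  apply/eqP => e; rewrite e in h.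
  have /eqP := jp; have /eqP := jq; rewrite -!val_eqE /= pq; lia.
by apply/eqP; case: ifP => _ e; [apply: jp | apply: jq].
Qed.

Lemma skew_schur_tperm :
  (msym (tperm p q) (skew_schur_poly n la mu) = skew_schur_poly n la mu)%R.
Proof.
rewrite /skew_schur_poly raddf_sum /= (reindex_onto bk bk) /=; last exact: bkK.
apply: eq_big => [T|T /andP[sT /eqP bT]].
  apply/idP/idP => [/andP[s1 /eqP <-]|sT]; first exact: bk_ssyt.
  by rewrite bk_ssyt //= bkK.
have {}sT : ssyt T by rewrite -bT bk_ssyt.
rewrite -[RHS]prod_bk // rmorph_prod /=; apply: eq_bigr => c _.
rewrite msymX; congr 'X_[_]; apply/mnmP => j.
rewrite !mnmE tpermV; congr (nat_of_bool _).
by rewrite (can2_eq (tpermK p q) (tpermK p q)) eq_sym.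
Qed.
End Swap.

Lemma skew_schur_tperm_lt k : forall p q : 'I_n, q = p + k.+1 :> nat ->
  (msym (tperm p q) (skew_schur_poly n la mu) = skew_schur_poly n la mu)%R.
Proof.
elim: k => [|k IH] p q pq; first by apply: skew_schur_tperm; rewrite pq addn1.
have rn : p + k.+1 < n by have := ltn_ord q; lia.
pose r := Ordinal rn.
have -> : tperm p q = (tperm r q * tperm p r * tperm r q)%g.
  rewrite -{1}(tpermV r q) -mulgA -[(_ * _)%g]/(tperm p r ^ tperm r q)%g tpermJ.
  by rewrite tpermL tpermD // -val_eqE /= ?pq; apply/eqP => /=; lia.
have rq : q = r.+1 :> nat by rewrite pq addnS.
by rewrite !msymMm (skew_schur_tperm rq) IH // (skew_schur_tperm rq).
Qed.

Lemma skew_schur_symmetric : (skew_schur_poly n la mu \is symmetric)%R.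
Proof.
apply/issymP => s; have [ts -> _] := prod_tpermP s.
elim: ts => [|[p q] ts IH]; first by rewrite big_nil msym1m.
rewrite big_cons msymMm /= -[RHS]IH; congr msym.
case: (ltngtP p q) => [l|l|/val_inj ->].
- by apply: (skew_schur_tperm_lt (k := q - p.+1)); lia.
- by rewrite tpermC; apply: (skew_schur_tperm_lt (k := p - q.+1)); lia.
- by rewrite tperm1 msym1m.
Qed.
End BenderKnuth.

Local Open Scope ring_scope.

Lemma skew_schur_restrict (la mu : intpart) n :
  restrict_poly (skew_schur_poly n.+1 la mu) = skew_schur_poly n la mu.
Proof.
pose h (T : {ffun cell la mu -> 'I_n}) : {ffun cell la mu -> 'I_n.+1} :=
  [ffun c => lift ord_max (T c)].
have h_inj : injective h.
  by move=> T U /ffunP e; apply/ffunP => c; have := e c; rewrite !ffunE => /lift_inj.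
have h_ssyt T : ssyt (h T) = ssyt T.
  apply: eq_forallb => c; apply: eq_forallb => d; rewrite !ffunE !lift_max.
  by [].
rewrite /restrict_poly /skew_schur_poly raddf_sum /=.
rewrite (bigID (fun T => T \in [set h T | T in predT])) /=.
rewrite [X in _ + X]big1 ?addr0 => [|T /andP[_ hT]].
  under eq_bigl do rewrite andbC.
  rewrite big_imset_cond; last by move=> T U _ _; apply: h_inj.
  apply: eq_big => [T|T _]; first by rewrite h_ssyt.
  rewrite rmorph_prod; apply: eq_bigr => c _ /=.
  by rewrite comp_mpolyXU -tnth_nth tnth_mktuple ffunE liftK.
rewrite rmorph_prod; have [c /eqP cm|H] := pickP (fun c => T c == ord_max).
  by rewrite (bigD1 c) //= comp_mpolyXU -tnth_nth tnth_mktuple cm unlift_none mul0r.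
case/imsetP: hT.
have H' c : exists j, T c == lift ord_max j.
  have := H c; case: (unliftP ord_max (T c)) => [j -> _|->]; last by rewrite eqxx.
  by exists j.
exists [ffun c => xchoose (H' c)] => //; apply/ffunP => c; rewrite !ffunE.
exact/eqP/(xchooseP (H' c)).
Qed.

Lemma skew_schur_deg (la mu : intpart) :
  exists d, forall n, (msize (skew_schur_poly n la mu) <= d)%N.
Proof.
exists #|cell la mu|.+1 => n; apply: leq_trans (msize_sum _ _ _) _.
apply/bigmax_leqP => T _; rewrite mprodXE msizeX ltnS mdeg_sum.
by rewrite (eq_bigr (fun=> 1%N)) ?sum1_card // => c _; rewrite mdeg1.
Qed.

(* Only the boxes of la outside mu are filled, so skew_schur la mu is the skew
   Schur function S_(la/mu) when mu is contained in la. *)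
Definition skew_schur (la mu : intpart) : symfun :=
  SymFun (fun n => skew_schur_symmetric la mu n)
    (skew_schur_restrict la mu) (skew_schur_deg la mu).

Definition schur (la : intpart) : symfun := skew_schur la empty_part.

(* The value of f in the variables of X and Y together, |X| = k and |Y| = l, is
   f (k + l). *)
Definition doubly_symmetric (f : symfun) : Prop :=
  exists m : {fsfun intpart -> rat with 0},
    f = \sum_(la <- finsupp m) m la *: schur la /\
    forall k l : nat,
      \sum_(la <- finsupp m) m la *: schur la (k + l)%N =
      \sum_(la <- finsupp m) m la *: hook_schur k l la.

Definition in_ideal_gen (R : comNzRingType) (G : R -> Prop) (f : R) : Prop :=
  exists2 s : seq (R * R),
    forall p, p \in s -> G p.2 & f = \sum_(p <- s) p.1 * p.2.

(* Main.v *)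
(* Evaluating f at even letters x and odd letters y, where S_la goes to the hook Schur
   function HS_la(x; y), gives a ring morphism: removing an even letter c is the
   substitution f(v) |-> f(v, c), and removing an odd letter c is inverse to removing
   the even letter -c, because horizontal and vertical strips cancel. Hence a power sum
   p_j evaluates to the sum of the x_i^j minus that of the (-y_i)^j. Since D(f)(v) is
   the value of f at v taken both as odd and as even letters, D is a ring morphism with
   D(p_j) = 2 p_j for j odd and 0 for j even. The power sums generate the algebra, so
   every f is D(a) + b with b in the ideal, and the ideal lies in the kernel. Finally D
   is injective on doubly symmetric g: there D(g)(v) = g(v, v), and g evaluated at m
   copies of v is a polynomial in m, which vanishes if it does so at all even m. *)
Require Import Defs.
From HB Require Import structures.
From mathcomp Require Import all_boot all_order all_algebra.
From mathcomp Require Import perm fingroup finmap mpoly boolp zify ring.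
Set Implicit Arguments.
Unset Strict Implicit.
Unset Printing Implicit Defensive.
Import Order.TTheory GRing.Theory.

Implicit Types (la mu nu : intpart).

(** * Partitions and strips *)

(** The obstacle is multiplicativity: hook functions and the conjugation of Schur functions are
    defined linearly on the Schur basis, where products are hard to read. Only even letters are
    visibly multiplicative, being substitutions; odd letters inherit this as inverses of bijective
    ring morphisms. After that, every claim about ring morphisms is checked on power sums.

    Surjectivity and the kernel come from one decomposition. If g = D(a) + b is doubly symmetric
    with b in the ideal, then b = g - D(a) is doubly symmetric too, and D(b) = 0 forces b = 0. If f
    = D(a) + b and D(f) = 0, then D(D(a)) = 0; as D(a) is doubly symmetric, injectivity gives D(a) =
    0 and f = b. *)

Lemma part_ext la mu : (forall i, nth 0 la i = nth 0 mu i) -> la = mu.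
Proof.
have sz (a b : intpart) :
    (forall i, nth 0 a i = nth 0 b i) -> size b <= size a.
  move=> e; rewrite leqNgt; apply/negP => /Defs.part_gt0.
  by rewrite -e nth_default.
move=> e; apply/val_inj/(@eq_from_nth _ 0) => [|i _]; last exact: e.
by apply/eqP; rewrite eqn_leq !sz.
Qed.

Lemma part_exists (f : nat -> nat) N :
  (forall i, f i.+1 <= f i) -> f N = 0 ->
  exists la, forall i, nth 0 la i = f i.
Proof.
move=> fS fN; have fmono i j : i <= j -> f j <= f i.
  by move/subnK => <-; elim: (j - i) => // k /(leq_trans (fS _)).
have ex : exists n, f n == 0 by exists N; apply/eqP.
case: (ex_minnP ex) => K /eqP fK minK.
have H : sorted geq (mkseq f K) && (0 \notin mkseq f K).
  apply/andP; split.
    apply: (homo_sorted (e := leq)); last exact: iota_sorted.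
    by move=> i j; apply: fmono.
  apply/mapP => -[i]; rewrite mem_iota => iK /esym/eqP /minK.
  by rewrite leqNgt; case/andP: iK => _ ->.
exists (IntPart H) => i /=; have [iK|Ki] := ltnP i K; first by rewrite nth_mkseq.
rewrite nth_default ?size_mkseq //; apply/esym/eqP.
by rewrite -leqn0 -fK fmono.
Qed.

(** The parts decrease, so those exceeding j form an initial segment. This yields the symmetric
    description [conj_partP] of conjugation, from which its other properties follow. *)
Lemma count_gt_part la i j : (i < count (fun p => j < p) la) = (j < nth 0 la i).
Proof.
have /andP[srt _] := pvalP la; have geq_tr : transitive geq.
  by move=> a b c /= h1 h2; apply: leq_trans h2 h1.
elim: (Defs.pval la) srt i => [|a s IH] /= srt i; first by rewrite nth_nil ltn0.
have srt' := path_sorted srt.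
have all_le : all (geq a) s by apply: order_path_min srt.
have [ja|aj] := ltnP j a; last first.
  rewrite add0n (_ : count _ s = 0).
    case: i => [|i] /=; first by lia.
    have [/(mem_nth 0)/(allP all_le) /= h|h] := ltnP i (size s); first by lia.
    by rewrite nth_default.
  by apply/eqP; rewrite -leqn0 leqNgt -has_count; apply/hasPn => p /(allP all_le) /=; lia.
by case: i => [|i] /=; rewrite ?ja // add1n ltnS IH.
Qed.

Lemma nth_conj la j : nth 0 (conj_part la) j = count (fun p => j < p) la.
Proof.
rewrite /= /conj_seq; have [jh|hj] := ltnP j (head 0 la).
  by rewrite (nth_map 0) ?size_iota // nth_iota.
rewrite nth_default ?size_map ?size_iota //; apply/esym/eqP.
by rewrite -leqn0 leqNgt count_gt_part nth0 -leqNgt.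
Qed.

Lemma conj_partP la i j : (i < nth 0 (conj_part la) j) = (j < nth 0 la i).
Proof. by rewrite nth_conj count_gt_part. Qed.

Lemma eq_nat_ltn a b : (forall i, (i < a) = (i < b)) -> a = b.
Proof. by move=> h; have := h a; have := h b; lia. Qed.

Lemma conj_partK : involutive conj_part.
Proof.
by move=> la; apply: part_ext => i; apply: eq_nat_ltn => j; rewrite !conj_partP.
Qed.

Lemma sumn_part N la : size la <= N -> sumn la = \sum_(i < N) nth 0 la i.
Proof.
move=> /subnKC <-; rewrite big_split_ord /= [X in _ + X]big1 => [|i _].
  by rewrite addn0 sumnE (big_nth 0) big_mkord.
by rewrite nth_default // leq_addr.
Qed.

Lemma sum_ltn a M : \sum_(j < M) (j < a) = minn a M.
Proof. by elim: M => [|M IH]; rewrite ?big_ord0 ?big_ord_recr /= ?IH; lia. Qed.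

(** Double counting of the cells (i, j) with j < la_i. *)
Lemma sumn_conj la : sumn (conj_part la) = sumn la.
Proof.
set M := size (conj_part la).
rewrite (sumn_part (leqnn _)) (sumn_part (leqnn _)) -/M.
rewrite (eq_bigr (fun j : 'I_M => \sum_(i < size la) (j < nth 0 la i))).
  rewrite exchange_big /=; apply: eq_bigr => i _; rewrite sum_ltn.
  apply/minn_idPl; rewrite leqNgt -conj_partP nth_default //.
move=> j _; rewrite (eq_bigr (fun i : 'I_(size la) => (i < nth 0 (conj_part la) j) : nat)).
  by rewrite sum_ltn; apply/esym/minn_idPl; rewrite nth_conj count_size.
by move=> i _; rewrite conj_partP.
Qed.

(** For nu inside la, [true] allows at most one box of la/nu in each row, and [false] at most one in
    each column. Inclusion is left to the sums over [subparts la]; rows beyond [size la] impose no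
    condition. *)
Definition strip (b : bool) (la nu : seq nat) : bool :=
  all (fun i => if b then nth 0 la i <= (nth 0 nu i).+1
                else nth 0 la i.+1 <= nth 0 nu i) (iota 0 (size la)).

Lemma stripP b (la nu : seq nat) :
  reflect (forall i, if b then nth 0 la i <= (nth 0 nu i).+1
                     else nth 0 la i.+1 <= nth 0 nu i) (strip b la nu).
Proof.
apply: (iffP allP) => [h i|h i _]; last exact: h.
have [il|li] := ltnP i (size la); first by apply: h; rewrite mem_iota.
by rewrite [nth 0 la i]nth_default // [nth 0 la i.+1]nth_default ?if_same // ltnW.
Qed.

Lemma strip_conj b la nu : strip b (conj_part la) (conj_part nu) = strip (~~ b) la nu.
Proof.
have vh la' nu' : strip true la' nu' = strip false (conj_part la') (conj_part nu').
  apply/stripP/stripP => h i.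
    rewrite leqNgt; apply/negP; rewrite conj_partP => h1.
    have : nth 0 (conj_part la') i.+1 <= nth 0 (conj_part nu') i.
      rewrite leqNgt; apply/negP => l.
      by move: l (h (nth 0 (conj_part nu') i)); rewrite conj_partP
        -[i.+1 < _]/(i.+2 <= _) => h2 h3; have := leq_trans h2 h3;
        rewrite ltnS -conj_partP ltnn.
    by rewrite -conj_partP in h1; lia.
  rewrite leqNgt; apply/negP; rewrite -conj_partP => l.
  by have := leq_trans l (h _); rewrite conj_partP ltnn.
by case: b; [rewrite vh !conj_partK | rewrite -vh].
Qed.

Lemma included_conj mu la : included (conj_part mu) (conj_part la) = included mu la.
Proof.
have h mu' la' : included mu' la' -> included (conj_part mu') (conj_part la').
  move=> /includedP h; apply/includedP => j; rewrite leqNgt; apply/negP.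
  by rewrite conj_partP => /leq_trans/(_ (h _)); rewrite -conj_partP ltnn.
by apply/idP/idP => /h //; rewrite !conj_partK.
Qed.

Lemma included_refl la : included la la. Proof. exact/includedP. Qed.

Lemma included_trans mu nu la : included mu nu -> included nu la -> included mu la.
Proof.
move=> /includedP h1 /includedP h2; apply/includedP => i.
exact: leq_trans (h1 i) (h2 i).
Qed.

Lemma included_sumn mu la : included mu la -> sumn mu <= sumn la.
Proof.
move=> /includedP h; pose N := maxn (size mu) (size la).
rewrite (@sumn_part N) ?leq_maxl // (@sumn_part N la) ?leq_maxr //.
by apply: leq_sum.
Qed.

Local Open Scope ring_scope.

Lemma perm_subparts_conj la :
  perm_eq (subparts (conj_part la)) (map conj_part (subparts la)).
Proof.
apply: uniq_perm; rewrite ?subparts_uniq ?(map_inj_uniq (can_inj conj_partK)) //.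
  exact: subparts_uniq.
move=> mu; rewrite mem_subparts -{2}(conj_partK mu).
by rewrite (mem_map (can_inj conj_partK)) mem_subparts -included_conj conj_partK.
Qed.

(** Brings inner sums over [subparts nu] to the fixed range [subparts la], so that double sums over
    chains of partitions can be exchanged. *)
Lemma big_subparts (V : nmodType) la nu (F : intpart -> V) :
  included nu la -> (forall mu, ~~ included mu nu -> F mu = 0) ->
  \sum_(mu <- subparts nu) F mu = \sum_(mu <- subparts la) F mu.
Proof.
move=> nl F0; rewrite [RHS](bigID (fun mu => included mu nu)) /=.
rewrite [X in _ + X]big1 ?addr0 => [|mu]; last exact: F0.
rewrite -[RHS]big_filter; apply: perm_big; apply: uniq_perm.
- exact: subparts_uniq.
- exact/filter_uniq/subparts_uniq.
move=> mu; rewrite mem_filter !mem_subparts; case: (boolP (included mu nu)) => //= h.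
by rewrite (included_trans h nl).
Qed.

Lemma big_subparts1 (V : nmodType) la nu (F : intpart -> V) :
  included nu la -> (forall mu, mu != nu -> F mu = 0) ->
  \sum_(mu <- subparts la) F mu = F nu.
Proof.
move=> nl F0; rewrite (bigD1_seq nu) ?subparts_uniq ?mem_subparts //=.
by rewrite big1 ?addr0.
Qed.

(* A letter is a pair (b, x) of a parity and a value: the boxes of an odd letter
   (b = true) form a vertical strip, those of an even one a horizontal strip. The
   head of w is the largest letter, so that wsum w la mu sums over the
   tableaux of shape la/mu. *)
Fixpoint wsum (w : seq (bool * rat)) la mu : rat :=
  if w is (b, x) :: w' then
    \sum_(nu <- subparts la | strip b la nu) x ^+ (sumn la - sumn nu) * wsum w' nu mu
  else (la == mu)%:R.

Lemma wsum_eq0 w la mu : ~~ included mu la -> wsum w la mu = 0.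
Proof.
elim: w la => [|[b x] w IH] la /= h.
  by case: eqP h => // ->; rewrite included_refl.
rewrite big_seq_cond big1 // => nu; rewrite mem_subparts => /andP[nl _].
by rewrite IH ?mulr0 //; apply: contra h => /included_trans; apply.
Qed.

Lemma wsum_cat w1 w2 la mu :
  wsum (w1 ++ w2) la mu = \sum_(nu <- subparts la) wsum w1 la nu * wsum w2 nu mu.
Proof.
elim: w1 la => [|[b x] w1 IH] la /=.
  rewrite (big_subparts1 (included_refl la)) ?eqxx ?mul1r // => nu.
  by rewrite eq_sym => /negPf ->; rewrite mul0r.
under [RHS]eq_bigr do rewrite mulr_suml.
rewrite exchange_big /= big_seq_cond [RHS]big_seq_cond.
apply: eq_bigr => nu; rewrite mem_subparts => /andP[nl _].
rewrite IH (big_subparts nl) => [|k h]; last by rewrite wsum_eq0 ?mul0r.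
by rewrite mulr_sumr; apply: eq_bigr => k _; rewrite mulrA.
Qed.

(** Transposition exchanges horizontal and vertical strips, hence the parity of every letter. *)
Lemma wsum_conj w la mu :
  wsum [seq (~~ p.1, p.2) | p <- w] (conj_part la) (conj_part mu) = wsum w la mu.
Proof.
elim: w la => [|[b x] w IH] la /=; first by rewrite (inj_eq (can_inj conj_partK)).
rewrite (perm_big _ (perm_subparts_conj la)) big_map.
by apply: eq_big => [nu|nu _]; rewrite ?strip_conj ?negbK // !sumn_conj IH.
Qed.

(** The skew form of E(t) H(-t) = 1, by a sign-reversing involution. If r is the first row where la
    and mu differ, nu_r may be la_r or la_r - 1 whatever the other rows are: both are at least mu_r
    since mu_r < la_r, and at most mu_(r-1) = la_(r-1). Exchanging these two values, whose sum is 2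
    la_r - 1, flips the sign. *)
Lemma wsum_cancel c la mu :
  wsum [:: (true, c); (false, - c)] la mu = (la == mu)%:R.
Proof.
pose P nu := [&& strip true la nu, included mu nu & strip false nu mu].
have PP nu : included nu la -> P nu <-> forall i, [/\ (nth 0 la i <= (nth 0 nu i).+1)%N,
    (nth 0 nu i <= nth 0 la i)%N, (nth 0 mu i <= nth 0 nu i)%N &
    (nth 0 nu i.+1 <= nth 0 mu i)%N].
  move=> /includedP nl; split=> [/and3P[/stripP h1 /includedP h2 /stripP h3] i|h].
    by split; [apply: h1 | apply: nl | apply: h2 | apply: h3].
  apply/and3P; split; first by apply/stripP => i; have [] := h i.
    by apply/includedP => i; have [] := h i.
  by apply/stripP => i; have [] := h i.
have -> : wsum [:: (true, c); (false, - c)] la mu =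
    \sum_(nu <- subparts la | P nu) c ^+ (sumn la - sumn nu) * (- c) ^+ (sumn nu - sumn mu).
  rewrite /= big_mkcond [RHS]big_mkcond; apply: eq_bigr => nu _ /=.
  rewrite /P; case: (strip true la nu) => //=.
  have [mn|mn] := boolP (included mu nu); last first.
    rewrite /= big_seq_cond big1 ?mulr0 // => k.
    rewrite mem_subparts; case: eqP => [->|_]; last by rewrite mulr0.
    by rewrite (negPf mn).
  rewrite big_mkcond (big_subparts1 mn) => [|k /negPf ->]; last first.
    by rewrite mulr0 if_same.
  by rewrite eqxx mulr1 /=; case: ifP => // _; rewrite mulr0.
have [e|/eqP lm] := eqVneq la mu.
  subst mu.
  rewrite big_seq_cond (eq_bigl (pred1 la)).
    by rewrite -big_filter filter_pred1_uniq ?subparts_uniq ?mem_subparts ?included_refl //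
      big_seq1 !subnn !expr0 mulr1.
  move=> nu /=; rewrite mem_subparts; apply/andP/eqP => [[nl /(PP _ nl) h]|->].
    by apply: part_ext => i; have [] := h i; lia.
  split; first exact: included_refl.
  by apply/(PP _ (included_refl la)) => i; split=> //; apply: part_geq.
have [lml|lml] := boolP (included mu la); last first.
  rewrite big_seq_cond big1 // => nu; rewrite mem_subparts => /and4P[nl _ mn _].
  by rewrite (included_trans mn nl) in lml.
have ex : exists i, nth 0%N la i != nth 0%N mu i.
  apply: contrapT => h; apply/lm/part_ext => i; apply/eqP/negPn/negP => h1.
  by apply: h; exists i.
case: (ex_minnP ex) => r lmr minr; move/includedP: (lml) => lml'.
have lr : (nth 0 mu r < nth 0 la r)%N by rewrite ltn_neqAle eq_sym lmr lml'.
have lt_r i : (i < r)%N -> nth 0%N la i = nth 0%N mu i.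
  by move=> ir; apply/eqP/negPn/negP => /minr; rewrite leqNgt ir.
(* The row r of nu may be changed freely between la_r and la_r - 1. *)
pose tg nu i := (if i == r then ((nth 0 la r).*2.-1 - nth 0 nu r) else nth 0 nu i)%N.
(* Stated for all nu, so that choice gives a total map; its values outside the admissible nu are
   arbitrary. *)
have ex_tg nu : exists k : intpart, P nu && included nu la ->
    forall i, nth 0%N k i = tg nu i.
  have [/andP[Pn nl]|_] := boolP (P nu && included nu la); last by exists nu.
  have h := (PP _ nl).1 Pn.
  have [//|//|k hk] := @part_exists (tg nu) (maxn r.+1 (size la)).
  - move=> i; rewrite /tg; have [h1 h2 h3 h4] := h i; have [h1' h2' h3' h4'] := h i.+1.
    case: (eqVneq i.+1 r) => [e|_]; case: (eqVneq i r) => [e'|_]; try lia.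
    + by move: h1' h2'; rewrite e; have := lt_r i; have := part_geq la (leqnSn i); rewrite e; lia.
    + by move: h1 h2; rewrite e' in h4 *; lia.
  - rewrite /tg gtn_eqF ?leq_maxl //; have [_ + _ _] := h (maxn r.+1 (size la)).
    by rewrite [nth 0%N la _]nth_default ?leq_maxr //; lia.
  by exists k.
have [tog togP] := choice ex_tg.
have tog_in nu : P nu && included nu la -> P (tog nu) && included (tog nu) la.
  move=> Pnl; have e := togP _ Pnl; move: Pnl => /andP[Pn nl].
  have h := (PP _ nl).1 Pn.
  have h' i : [/\ (nth 0 la i <= (nth 0 (tog nu) i).+1)%N,
    (nth 0 (tog nu) i <= nth 0 la i)%N, (nth 0 mu i <= nth 0 (tog nu) i)%N &
    (nth 0 (tog nu) i.+1 <= nth 0 mu i)%N].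
    have [h1 h2 h3 h4] := h i; have [h1' h2' h3' h4'] := h i.+1; rewrite !e /tg.
    case: (eqVneq i.+1 r) => [e1|_]; case: (eqVneq i r) => [e'|_]; split; try lia;
      try by rewrite e' in h1 h2 h3 h4 *; lia.
    by have := lt_r i; have := part_geq la (leqnSn i); rewrite e1 in h1' h2' *; lia.
  have nl' : included (tog nu) la by apply/includedP => i; have [] := h' i.
  by rewrite nl' andbT; apply/(PP _ nl').
have togK nu : P nu && included nu la -> tog (tog nu) = nu.
  move=> Pnl; apply: part_ext => i; rewrite togP ?tog_in // /tg !togP // /tg eqxx.
  case: eqP => // ->; move: Pnl => /andP[Pn nl]; have [] := (PP _ nl).1 Pn r; lia.
have tog_odd nu : P nu && included nu la -> odd (sumn (tog nu)) = ~~ odd (sumn nu).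
  move=> Pnl; set N := maxn (size nu) (maxn (size (tog nu)) r.+1).
  rewrite !(@sumn_part N) ?leq_max ?leqnn ?orbT //.
  have rN : (r < N)%N by rewrite !leq_max leqnn !orbT.
  rewrite (bigD1 (Ordinal rN)) //= [in RHS](bigD1 (Ordinal rN)) //= togP // /tg eqxx !oddD.
  rewrite -addNb; congr (_ (+) odd _); last first.
    apply: eq_bigr => i /negPf; rewrite -val_eqE /= togP // /tg => -> //.
  move: Pnl => /andP[Pn nl]; have [] := (PP _ nl).1 Pn r; lia.
pose F nu := c ^+ (sumn la - sumn nu) * (- c) ^+ (sumn nu - sumn mu).
have S0 : \sum_(nu <- subparts la | P nu) F nu = - \sum_(nu <- subparts la | P nu) F nu.
  rewrite -[in RHS]big_filter -[LHS]big_filter -sumrN.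
  have -> : \sum_(nu <- [seq nu <- subparts la | P nu]) F nu =
            \sum_(nu <- map tog [seq nu <- subparts la | P nu]) F nu.
    apply: perm_big; apply: uniq_perm; first exact/filter_uniq/subparts_uniq.
      rewrite map_inj_in_uniq; first exact/filter_uniq/subparts_uniq.
      move=> a b; rewrite !mem_filter !mem_subparts => ha hb e.
      by rewrite -(togK _ ha) e togK.
    move=> nu; rewrite mem_filter mem_subparts.
    apply/idP/mapP => [h|[k + ->]]; last by rewrite mem_filter mem_subparts => /tog_in.
    by exists (tog nu); rewrite ?togK // mem_filter mem_subparts tog_in.
  rewrite big_map big_seq [RHS]big_seq; apply: eq_bigr => nu.
  rewrite mem_filter mem_subparts => Pnl.
  (* The exponents of c add up to |la| - |mu|, so nu enters its term only through the parity of
     |nu|. *)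
  have le1 k : P k && included k la ->
      F k = (-1) ^+ odd (sumn k) * ((-1) ^+ odd (sumn mu) * c ^+ (sumn la - sumn mu)).
    move=> /andP[/and3P[_ mk _] kl]; rewrite /F (exprNn c) mulrCA -exprD.
    rewrite addnBA ?included_sumn // subnK ?included_sumn // mulrA; congr (_ * _).
    by rewrite !signr_odd -[in RHS](subnK (included_sumn mk)) exprD -mulrA -expr2
       sqrr_sign mulr1.
  by rewrite !le1 ?tog_in // tog_odd // signrN mulNr.
by move: S0 => /eqP; rewrite -addr_eq0 -mulr2n Num.Theory.mulrn_eq0 /= => /eqP ->.
Qed.

(** * Tableaux as chains of strips *)

Definition extend_ffun (C D : finType) (up : D -> C) n (T : {ffun D -> 'I_n}) :
    {ffun C -> 'I_n.+1} :=
  [ffun c => if [pick d | up d == c] is Some d then widen_ord (leqnSn n) (T d)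
             else ord_max].

Section ExtendFfun.
Variables (C D : finType) (up : D -> C) (n : nat).
Hypothesis up_inj : injective up.
Implicit Types (T : {ffun D -> 'I_n}).

Lemma extend_ffun_up T d : extend_ffun up T (up d) = widen_ord (leqnSn n) (T d).
Proof.
by rewrite ffunE; case: pickP => [d' /eqP/up_inj -> //|/(_ d)]; rewrite eqxx.
Qed.

Lemma extend_ffun_max T c : c \notin codom up -> extend_ffun up T c = ord_max.
Proof.
rewrite ffunE; case: pickP => // d /eqP <-.
by rewrite codom_f.
Qed.

Lemma extend_ffun_lt T c : (extend_ffun up T c < n)%N = (c \in codom up).
Proof.
have [/codomP [d ->]|h] := boolP (c \in codom up).
  by rewrite extend_ffun_up /= ltn_ord.
by rewrite extend_ffun_max //= ltnn.
Qed.

(** Fillings of C whose largest letter sits exactly off the image of [up] are the extensions of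
    fillings of D, and each cell off the image contributes [v n]. *)
Lemma sum_extend_ffun (P : pred {ffun C -> 'I_n.+1}) (v : nat -> rat) :
  \sum_(T | P T && [forall c, (T c < n)%N == (c \in codom up)]) \prod_c v (T c)
  = v n ^+ #|[predC codom up]| *
    \sum_(T : {ffun D -> 'I_n} | P (extend_ffun up T)) \prod_d v (T d).
Proof.
have ext_inj : injective (@extend_ffun C D up n).
  move=> T U /ffunP e; apply/ffunP => d; have := e (up d).
  by rewrite !extend_ffun_up => /(congr1 val) /= /val_inj.
have extP T : [forall c, (extend_ffun up T c < n)%N == (c \in codom up)].
  by apply/forallP => c; rewrite extend_ffun_lt.
have im (U : {ffun C -> 'I_n.+1}) : [forall c, (U c < n)%N == (c \in codom up)] ->
    U \in [set extend_ffun up T | T in predT].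
  move=> /forallP h.
  have ex d : exists j : 'I_n, val (U (up d)) == j.
    by have /eqP := h (up d); rewrite codom_f => l; exists (Ordinal l).
  apply/imsetP; exists [ffun d => xchoose (ex d)] => //; apply/ffunP => c.
  apply: val_inj; have [/codomP [d ->]|hc] := boolP (c \in codom up).
    by rewrite extend_ffun_up ffunE /=; apply/eqP/(xchooseP (ex d)).
  rewrite extend_ffun_max //=; have /eqP := h c; rewrite (negPf hc) => /negbT.
  by have := ltn_ord (U c); lia.
transitivity (\sum_(U in [set extend_ffun up T | T in predT] | P U) \prod_c v (U c)).
  apply: eq_bigl => U; rewrite andbC; congr (_ && _).
  by apply/idP/idP => [/im|/imsetP[T _ ->]].
rewrite big_imset_cond; last by move=> T U _ _; apply: ext_inj.
rewrite mulr_sumr; apply: eq_bigr => T _.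
rewrite (bigID (fun c => c \in codom up)) /= mulrC; congr (_ * _).
  rewrite -prodr_const; apply: eq_big => [c|c h]; first by rewrite inE.
  by rewrite extend_ffun_max.
rewrite (eq_bigl (fun c => c \in [set up d | d in predT])); last first.
  by move=> c; apply/codomP/imsetP => [[d ->]|[d _ ->]]; exists d.
rewrite big_imset; last by move=> d d' _ _; apply: up_inj.
by apply: eq_bigr => d _; rewrite extend_ffun_up.
Qed.
End ExtendFfun.

(* The letter i is odd when ty i holds. *)
Definition gen_tab (ty : nat -> bool) n (la mu : seq nat) (T : {ffun cell la mu -> 'I_n}) :=
  [forall c, forall d,
     ((cell_row c == cell_row d) && (cell_col c < cell_col d)%N ==>
        (T c <= T d)%N && ((T c == T d) ==> ~~ ty (T c)))
  && ((cell_col c == cell_col d) && (cell_row c < cell_row d)%N ==>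
        (T c <= T d)%N && ((T c == T d) ==> ty (T c)))].

Lemma gen_tabP (ty : nat -> bool) n (la mu : seq nat) (T : {ffun cell la mu -> 'I_n}) :
  reflect ((forall c d, cell_row c = cell_row d -> (cell_col c < cell_col d)%N ->
              (T c <= T d)%N /\ (T c = T d -> ~~ ty (T c))) /\
           (forall c d, cell_col c = cell_col d -> (cell_row c < cell_row d)%N ->
              (T c <= T d)%N /\ (T c = T d -> ty (T c)))) (gen_tab ty T).
Proof.
apply: (iffP forallP) => [h|[h1 h2] c].
  by split=> c d e l; have /forallP/(_ d)/andP[] := h c; rewrite e eqxx l /=;
     [move=> /andP[-> /implyP i] _|move=> _ /andP[-> /implyP i]]; split=> // /eqP.
apply/forallP => d; apply/andP; split; apply/implyP => /andP[/eqP e l].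
  by have [-> i] := h1 c d e l; apply/implyP => /eqP/i.
by have [-> i] := h2 c d e l; apply/implyP => /eqP/i.
Qed.

Lemma ssyt_gen_tab n la mu (T : {ffun cell la mu -> 'I_n}) :
  ssyt T = gen_tab (fun=> false) T.
Proof.
apply: eq_forallb => c; apply: eq_forallb => d; rewrite implybT andbT; congr (_ && _).
by rewrite implybF -val_eqE [in LHS](ltn_neqAle (T c)) [in LHS](andbC (_ != _)).
Qed.

Lemma hook_ssyt_gen_tab k l la (T : {ffun cell la [::] -> 'I_(k + l)}) :
  hook_ssyt T = gen_tab (fun i => (k <= i)%N) T.
Proof. by apply: eq_forallb => c; apply: eq_forallb => d; rewrite -ltnNge. Qed.

(** In decreasing order, because [wsum] removes the outermost strip, that of the largest letter,
    first. *)
Fixpoint letters (ty : nat -> bool) (v : nat -> rat) n : seq (bool * rat) :=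
  if n is n'.+1 then (ty n', v n') :: letters ty v n' else [::].

Lemma eq_letters (ty ty' : nat -> bool) (v v' : nat -> rat) n :
  (forall i, (i < n)%N -> ty i = ty' i) -> (forall i, (i < n)%N -> v i = v' i) ->
  letters ty v n = letters ty' v' n.
Proof.
elim: n => //= n IH h h'; rewrite h ?h' // IH // => i l; [apply: h|apply: h'];
exact: ltnW.
Qed.

Section Shape.
Variables (ty : nat -> bool) (n : nat) (la mu : intpart).
Hypothesis mula : included mu la.
Local Notation cell := (cell la mu).
Local Notation row := (@cell_row la mu).
Local Notation col := (@cell_col la mu).
Implicit Types (T : {ffun cell -> 'I_n.+1}).

(** nu/mu consists of the cells whose letter is below the largest letter n. *)
Definition shape_rel T nu :=
  included mu nu && [forall c, (T c < n)%N == (col c < nth 0 nu (row c))%N].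

Lemma shape_exists T : gen_tab ty T ->
  exists nu, included nu la /\ shape_rel T nu.
Proof.
move=> /gen_tabP[hr hc].
(* Row r of the shape ends after its last letter below n, or at mu_r if there is none. Weakly
   increasing columns make f decreasing: the cell above a small letter is small or lies in mu. *)
pose f r := maxn (nth 0 mu r) (\max_(c | (row c == r) && (T c < n)%N) (col c).+1).
have f_le r : (f r <= nth 0 la r)%N.
  rewrite /f geq_max (includedP _ _ mula) /=.
  by apply/bigmax_leqP => c /andP[/eqP <- _]; have /andP[] := cell_bounds c.
have lt_f c : (T c < n)%N -> (col c < f (row c))%N.
  by move=> h; rewrite leq_max (bigop.bigmax_sup c) ?orbT // eqxx.
have [||nu nuE] := @part_exists f (size la).
- move=> r; rewrite {1}/f geq_max leq_max part_geq //=.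
  apply/bigmax_leqP => c /andP[/eqP cr Tc].
  have [l|l] := ltnP (col c) (nth 0%N mu r); first by rewrite leq_max l.
  have /andP[_ b] := cell_bounds c; rewrite cr in b.
  have [|d [dr dc]] := @cell_exists la mu r (col c).
    by rewrite l (leq_trans b) // part_geq.
  have [//||le _] := hc d c; first by rewrite dr cr.
  by rewrite -dc -dr lt_f // (leq_ltn_trans le).
- by apply/eqP; rewrite -leqn0 (leq_trans (f_le _)) // nth_default.
exists nu; split; first by apply/includedP => i; rewrite nuE f_le.
apply/andP; split; first by apply/includedP => i; rewrite nuE leq_maxl.
apply/forallP => c; apply/eqP; rewrite nuE; apply/idP/idP; first exact: lt_f.
apply: contraLR; rewrite -!leqNgt => nc; rewrite geq_max.
have /andP[-> _] := cell_bounds c; apply/bigmax_leqP => d /andP[/eqP dr Td].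
rewrite ltnNge leq_eqVlt; apply/negP => /orP[/eqP e|l].
  by rewrite -(@cell_inj la mu c d) // in Td; rewrite leqNgt Td in nc.
by have [|le _] := hr c d _ l => //; lia.
Qed.

(** Inclusion in la matters: [shape_rel] tests only cells of la/mu and says nothing of nu outside
    la. *)
Lemma shape_uniq T nu nu' : included nu la -> included nu' la ->
  shape_rel T nu -> shape_rel T nu' -> nu = nu'.
Proof.
have le (a b : intpart) r : included a la -> shape_rel T a -> shape_rel T b ->
    (nth 0 a r <= nth 0 b r)%N.
  move=> /includedP al /andP[_ /forallP ha] /andP[/includedP mb /forallP hb].
  rewrite leqNgt; apply/negP => l.
  have [|c [cr cc]] := @cell_exists la mu r (nth 0 b r).
    by rewrite mb (leq_trans l).
  by have := ha c; have := hb c; rewrite cr cc l ltnn => /eqP ->.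
by move=> h1 h2 h3 h4; apply: part_ext => r; apply/eqP; rewrite eqn_leq !le.
Qed.

(** A violation would give two adjacent cells holding the letter n, in one row if n is odd and in
    one column if n is even. *)
Lemma shape_strip T nu : gen_tab ty T -> shape_rel T nu -> strip (ty n) la nu.
Proof.
move=> /gen_tabP[hr hc] /andP[/includedP mn /forallP hn].
have big c : (nth 0 nu (row c) <= col c)%N -> T c = ord_max.
  move=> h; apply: val_inj => /=; have /eqP := hn c; rewrite ltnNge.
  by have := ltn_ord (T c); lia.
apply/stripP => r; case tn: (ty n); rewrite leqNgt; apply/negP => l.
  have [|c [cr cc]] := @cell_exists la mu r (nth 0 nu r).
    by rewrite mn ltnW // ltnW.
  have [|d [dr dc]] := @cell_exists la mu r (nth 0 nu r).+1.
    by rewrite l andbT leqW.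
  have [||_] := hr c d; rewrite ?cr ?dr ?cc ?dc //.
  by rewrite !big ?cr ?dr ?cc ?dc //= tn => /(_ erefl).
have [|c [cr cc]] := @cell_exists la mu r (nth 0 nu r).
  by rewrite mn (leq_trans l) // part_geq.
have [|d [dr dc]] := @cell_exists la mu r.+1 (nth 0 nu r).
  by rewrite l andbT (leq_trans (part_geq _ (leqnSn r))).
have [||_] := hc c d; rewrite ?cr ?dr ?cc ?dc //.
by rewrite !big ?cr ?dr ?cc ?dc //= ?tn; [move/(_ erefl)|apply: part_geq].
Qed.
End Shape.

Section Letter.
Variables (ty : nat -> bool) (n : nat) (la mu nu : intpart).
Variable up : cell nu mu -> cell la mu.
Hypothesis up_row : forall d, cell_row (up d) = cell_row d.
Hypothesis up_col : forall d, cell_col (up d) = cell_col d.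

Lemma up_inj : injective up.
Proof. by move=> d e E; apply: cell_inj; rewrite -?up_row -?up_col E. Qed.

Lemma mem_codom_up c :
  (c \in codom up) = (cell_col c < nth 0 nu (cell_row c))%N.
Proof.
apply/codomP/idP => [[d ->]|l].
  by rewrite up_row up_col; have /andP[] := cell_bounds d.
have [|d [dr dc]] := @cell_exists nu mu (cell_row c) (cell_col c).
  by rewrite l andbT; have /andP[] := cell_bounds c.
by exists d; apply: cell_inj; rewrite ?up_row ?up_col.
Qed.

Lemma card_codom_up : included mu nu -> included nu la ->
  #|[predC codom up]| = (sumn la - sumn nu)%N.
Proof.
move=> munu nula; rewrite (sumn_part (leqnn _)) (@sumn_part (size la) nu); last first.
  rewrite leqNgt; apply/negP => /Defs.part_gt0.
  by rewrite ltnNge (leq_trans (includedP _ _ nula _)) // nth_default.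
rewrite -sumnB; last by move=> i _; apply: (includedP _ _ nula).
rewrite -(@card_between la mu (nth 0%N nu) (nth 0%N la)).
- apply: eq_card => c; rewrite !inE mem_codom_up -leqNgt.
  by have /andP[_ ->] := cell_bounds c; rewrite andbT.
- move=> r; rewrite (includedP _ _ nula) andbT /base.
  by rewrite (leq_trans (geq_minl _ _)) // (includedP _ _ munu).
- by move=> r; rewrite leqnn andbT geq_minr.
- exact/includedP.
Qed.

(** The new cells hold the largest letter, so they create no wrong inequality; equal letters
    involving one occur only between two new cells, where the strip condition excludes the forbidden
    alignment. *)
Lemma gen_tab_extend (T : {ffun cell nu mu -> 'I_n}) : strip (ty n) la nu ->
  gen_tab ty (extend_ffun up T) = gen_tab ty T.
Proof.
move=> /stripP st; have upI := up_inj.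
apply/gen_tabP/gen_tabP => -[hr hc]; split=> c d.
- move=> e l; have [||le i] := hr (up c) (up d); rewrite ?up_row ?up_col //.
  by move: le i; rewrite !extend_ffun_up //= => le i; split=> // E; apply: i; rewrite E.
- move=> e l; have [||le i] := hc (up c) (up d); rewrite ?up_row ?up_col //.
  by move: le i; rewrite !extend_ffun_up //= => le i; split=> // E; apply: i; rewrite E.
- move=> e l; have [/codomP[d' dE]|dn] := boolP (d \in codom up).
    have /codomP[c' cE] : c \in codom up.
      by rewrite mem_codom_up e (ltn_trans l) // -mem_codom_up dE codom_f.
    move: e l; rewrite dE cE !up_row !up_col => e l.
    have [le i] := hr _ _ e l; rewrite !extend_ffun_up //=; split=> // E.
    by apply: i; apply: val_inj; apply: (congr1 val E).
  rewrite (extend_ffun_max _ dn); split=> [|Ec]; first by rewrite -ltnS ltn_ord.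
  rewrite Ec /=; apply/negP => tn; have /= := st (cell_row d); rewrite tn.
  have : c \notin codom up.
    by rewrite -(extend_ffun_lt upI T) Ec /= ltnn.
  rewrite mem_codom_up -leqNgt e => h1 h2.
  by have /andP[_] := cell_bounds d; lia.
- move=> e l; have [/codomP[d' dE]|dn] := boolP (d \in codom up).
    have /codomP[c' cE] : c \in codom up.
      have := codom_f up d'; rewrite -dE !mem_codom_up e => h.
      by apply: leq_trans h _; apply: part_geq; apply: ltnW.
    move: e l; rewrite dE cE !up_row !up_col => e l.
    have [le i] := hc _ _ e l; rewrite !extend_ffun_up //=; split=> // E.
    by apply: i; apply: val_inj; apply: (congr1 val E).
  rewrite (extend_ffun_max _ dn); split=> [|Ec]; first by rewrite -ltnS ltn_ord.
  rewrite Ec /=; apply/negPn/negP => /negPf tn; have /= := st (cell_row c); rewrite tn.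
  have : c \notin codom up.
    by rewrite -(extend_ffun_lt upI T) Ec /= ltnn.
  rewrite mem_codom_up -leqNgt => h1 h2.
  have /andP[_] := cell_bounds d; have := part_geq la l; rewrite -e; lia.
Qed.
End Letter.

(** Induction on the number of letters: tableaux are sorted by the shape nu of their letters below
    the largest one, which then fills the strip la/nu. *)
Lemma sum_gen_tab (ty : nat -> bool) (v : nat -> rat) n la mu : included mu la ->
  \sum_(T : {ffun cell la mu -> 'I_n} | gen_tab ty T) \prod_c v (T c)
  = wsum (letters ty v n) la mu.
Proof.
elim: n la => [|n IH] la mula /=.
  have [->|ne] := eqVneq la mu.
    have no (c : cell mu mu) : False by have := cell_bounds c; lia.
    pose T0 : {ffun cell mu mu -> 'I_0} := [ffun c => False_rect _ (no c)].
    rewrite (big_pred1 T0) => [|T /=]; first by rewrite big1 // => c; case: (no c).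
    have -> : T = T0 by apply/ffunP => c; case: (no c).
    by rewrite eqxx; apply/gen_tabP; split=> c; case: (no c).
  rewrite big_pred0 // => T; have [i h] : exists i, (nth 0 mu i < nth 0 la i)%N.
    apply: contrapT => h; case/eqP: ne; apply: part_ext => i; apply/eqP.
    rewrite eqn_leq (includedP _ _ mula) andbT leqNgt; apply/negP => l.
    by apply: h; exists i.
  have [|c _] := @cell_exists la mu i (nth 0 mu i); first by rewrite leqnn.
  by case: (T c).
transitivity (\sum_(nu <- subparts la)
    \sum_(T : {ffun cell la mu -> 'I_n.+1} | gen_tab ty T && shape_rel T nu)
      \prod_c v (T c)).
  under [RHS]eq_bigr do rewrite big_mkcondr.
  rewrite exchange_big /=; apply: eq_bigr => T gT.
  have [nu [nl sh]] := shape_exists mula gT.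
  rewrite [RHS]big_seq [RHS](eq_bigr (fun nu' => if nu' == nu then \prod_c v (T c) else 0)).
    by rewrite -big_seq (big_subparts1 nl) ?eqxx // => nu' /negPf ->.
  move=> nu'; rewrite mem_subparts => nl'; case: ifP => [sh'|].
    by rewrite (shape_uniq nl' nl sh' sh) eqxx.
  by case: eqP => // ->; rewrite sh.
rewrite [RHS]big_mkcond /= big_seq [RHS]big_seq; apply: eq_bigr => nu.
rewrite mem_subparts => nl; case: ifP => [st|nst]; last first.
  by rewrite big_pred0 // => T; apply/andP => -[gT /(shape_strip mula gT)]; rewrite nst.
have [mn|mn] := boolP (included mu nu); last first.
  rewrite wsum_eq0 // mulr0 big_pred0 // => T.
  by rewrite /shape_rel (negPf mn) andbF.
(* The cell types of nu/mu and la/mu have different ordinal bounds, so the embedding is chosen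
   through coordinates. *)
have /fin_all_exists[up upP] (d : cell nu mu) :
    exists c : cell la mu, cell_row c = cell_row d /\ cell_col c = cell_col d.
  have /andP[h1 h2] := cell_bounds d; apply: cell_exists.
  by rewrite h1 (leq_trans h2) // (includedP _ _ nl).
have up_row d := (upP d).1; have up_col d := (upP d).2.
rewrite -(IH _ mn) -(card_codom_up up_row up_col mn nl).
under [in RHS]eq_bigl do rewrite -(gen_tab_extend up_row up_col _ st).
rewrite -(sum_extend_ffun (up_inj up_row up_col) (gen_tab ty (mu := mu))).
apply: eq_bigl => T; rewrite /shape_rel mn /=; congr (_ && _).
by apply: eq_forallb => c; rewrite (mem_codom_up up_row up_col).
Qed.

(** * Evaluation at rational points *)

Lemma skew_schur_meval n la mu (u : nat -> rat) : included mu la ->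
  (skew_schur la mu n).@[fun i => u i] = wsum (letters (fun=> false) u n) la mu.
Proof.
move=> ml; rewrite -sum_gen_tab // raddf_sum; apply: eq_big => [T|T _].
  exact: ssyt_gen_tab.
by rewrite /= rmorph_prod /=; apply: eq_bigr => c _; rewrite mevalXU.
Qed.

Lemma included0 la : included empty_part la.
Proof. by apply/includedP => i; rewrite nth_nil. Qed.

Lemma schur_meval n la (u : nat -> rat) :
  (schur la n).@[fun i => u i] = wsum (letters (fun=> false) u n) la empty_part.
Proof. exact/skew_schur_meval/included0. Qed.

Lemma hook_schur_meval k l la (u : nat -> rat) :
  (hook_schur k l la).@[fun i => u i] =
  wsum (letters (fun i => (k <= i)%N) u (k + l)) la empty_part.
Proof.
rewrite -sum_gen_tab ?included0 // raddf_sum; apply: eq_big => [T|T _].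
  exact: hook_ssyt_gen_tab.
by rewrite /= rmorph_prod /=; apply: eq_bigr => c _; rewrite mevalXU.
Qed.

Lemma skew_schur_conj_meval n la mu (u : nat -> rat) : included mu la ->
  (skew_schur (conj_part la) (conj_part mu) n).@[fun i => u i] =
  wsum (letters (fun=> true) u n) la mu.
Proof.
move=> ml; rewrite skew_schur_meval ?included_conj // -[RHS]wsum_conj; congr wsum.
by elim: n => //= n ->.
Qed.

Lemma poly_eq0_nat (R : idomainType) (q : {poly R}) (f : nat -> R) :
  injective f -> (forall m, q.[f m] = 0) -> q = 0.
Proof.
move=> fI h; apply: (@roots_geq_poly_eq0 _ _ (mkseq f (size q))).
- by apply/allP => _ /mapP[m _ ->]; apply/rootP.
- by rewrite map_inj_uniq ?iota_uniq.
- by rewrite size_mkseq.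
Qed.

Lemma natr_rat_inj : injective (fun m : nat => m%:R : rat).
Proof. by move=> a b /eqP; rewrite Num.Theory.eqr_nat => /eqP. Qed.

Lemma meval_muni n (p : {mpoly rat[n.+1]}) (u : nat -> rat) :
  p.@[fun i => u i] = (map_poly (meval (fun i : 'I_n => u i)) (muni p)).[u n].
Proof.
rewrite muniE mevalE raddf_sum horner_sum; apply: eq_bigr => m _ /=.
rewrite -mul_polyC rmorphM /= map_polyC map_polyXn hornerM hornerC hornerXn /=.
rewrite mevalZ mevalX big_ord_recr /= mulrA; congr (_ * _ * _).
by apply: eq_bigr => i _; rewrite mnmE.
Qed.

Lemma muni_eq0 n (R : nzRingType) (p : {mpoly R[n.+1]}) : muni p = 0 -> p = 0.
Proof.
move=> p0; apply/mpolyP => m; rewrite mcoeff0; apply/eqP.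
rewrite mcoeff_eq0; apply/negP => mp.
pose k := [multinom m (widen_ord (leqnSn n) i) | i < n].
have := congr1 (fun q : {poly {mpoly R[n]}} => q`_(m ord_max)@_k) p0.
rewrite coef0 mcoeff0 muniE coef_sum raddf_sum /= (bigD1_seq m) ?msupp_uniq //=.
rewrite big1 => [|m' nm]; last first.
  rewrite coefZ coefXn; case: eqP => [e|_]; last by rewrite mulr0 mcoeff0.
  rewrite mulr1 mcoeffZ mcoeffX (_ : _ == k = false) ?mulr0 //.
  apply: contraNF nm => /eqP/mnmP ek; apply/eqP/mnmP => i.
  have [j ->|->] := unliftP ord_max i; last by rewrite e.
  have := ek j; rewrite !mnmE; have -> // : widen_ord (leqnSn n) j = lift ord_max j.
  by apply: val_inj => /=; rewrite /bump leqNgt ltn_ord.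
rewrite addr0 coefZ coefXn eqxx mulr1 mcoeffZ mcoeffX eqxx mulr1 => /eqP.
by rewrite mcoeff_eq0 mp.
Qed.

(** Induction on the variables: with the others fixed, p is a polynomial in the last one with
    infinitely many roots, so its coefficients vanish at every point. Identities of symmetric
    functions can thus be tested on rational values. *)
Lemma mpoly_eq0_meval n (p : {mpoly rat[n]}) :
  (forall u : nat -> rat, p.@[fun i => u i] = 0) -> p = 0.
Proof.
elim: n p => [|n IH] p h.
  have := h (fun=> 0); have -> : p = (p@_0)%:MP; last by rewrite mevalC => ->.
  by rewrite -[LHS]mpolyKC.
apply: muni_eq0; apply/polyP => i; rewrite coef0; apply: IH => u.
pose q := map_poly (meval (fun i : 'I_n => u i)) (muni p).
suff q0 : q = 0 by rewrite -(coef_map _ (muni p)) -/q q0 coef0.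
apply: (poly_eq0_nat natr_rat_inj) => m.
pose u' i := if (i < n)%N then u i else m%:R.
rewrite -(h u') meval_muni /u' ltnn; congr (_.[_]); apply: eq_map_poly => r.
by apply: meval_eq => j; rewrite ltn_ord.
Qed.

Lemma symfun_eq (f g : symfun) :
  (forall n (u : nat -> rat), (f n).@[fun i => u i] = (g n).@[fun i => u i]) -> f = g.
Proof.
move=> h; apply: symfunP => n; apply/eqP; rewrite -subr_eq0; apply/eqP.
by apply: mpoly_eq0_meval => u; rewrite mevalB h subrr.
Qed.

(** * Bases of symmetric functions *)

Definition part_mnm n la : 'X_{1..n} := [multinom nth 0%N la i | i < n].

Lemma mdeg_part_mnm n la : (size la <= n)%N -> mdeg (part_mnm n la) = sumn la.
Proof.
by move=> h; rewrite (sumn_part h) mdegE; apply: eq_bigr => i _; rewrite mnmE.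
Qed.

(** The common property of Schur functions and of products of elementary functions from which
    spanning follows. The degree bound is required for every n, the leading monomial x^la only when
    there are enough variables to write it. *)
Definition unitriangular (b : intpart -> symfun) := forall la n,
  (msize (b la n) <= (sumn la).+1)%N /\
  ((size la <= n)%N ->
   mlead (b la n) = part_mnm n la /\ (b la n)@_(part_mnm n la) = 1).

(** * Leading monomials of Schur polynomials *)

Section SchurLead.
Variables (la : intpart) (n : nat).
Local Notation cell := (cell la empty_part).
Implicit Types (T : {ffun cell -> 'I_n}) (c : cell).

Definition content T : 'X_{1..n} := (\sum_c U_(T c))%MM.

Lemma contentE T i : content T i = #|[pred c | T c == i]|.
Proof.
rewrite mnm_sumE -sum1_card [RHS]big_mkcond; apply: eq_bigr => c _.
by rewrite mnm1E inE; case: eqP.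
Qed.

Lemma mdeg_content T : mdeg (content T) = #|cell|.
Proof. by rewrite mdeg_sum -sum1_card; apply: eq_bigr => c _; rewrite mdeg1. Qed.

Lemma schur_content : schur la n = \sum_(T : {ffun cell -> 'I_n} | ssyt T) 'X_[content T].
Proof. by apply: eq_bigr => T _; rewrite mprodXE. Qed.

(** Columns increase strictly from an entry that is at least 0. *)
Lemma row_le_ssyt T c : ssyt T -> (cell_row c <= T c)%N.
Proof.
move=> /ssytP[_ hc]; move: {2}(cell_row c) (leqnn (cell_row c)) => k.
elim: k c => [|k IH] c; first by rewrite leqn0 => /eqP ->.
case cr: (cell_row c) => [//|r]; rewrite ltnS => rk.
have /andP[h1 h2] := cell_bounds c; rewrite cr in h2.
have [|d [dr dc]] := @cell_exists la empty_part r (cell_col c).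
  by rewrite nth_nil /= (leq_trans h2) // part_geq.
by rewrite -cr in rk *; have := IH d; rewrite dr => /(_ rk) /leq_ltn_trans; rewrite cr;
  apply; apply: hc; rewrite ?dc ?dr ?cr.
Qed.

Hypothesis lan : (size la <= n)%N.

Fact row_lt c : (cell_row c < n)%N.
Proof. exact: leq_trans (ltn_ord (val c).1) lan. Qed.
Definition row_tab : {ffun cell -> 'I_n} := [ffun c => Ordinal (row_lt c)].

Lemma ssyt_row_tab : ssyt row_tab.
Proof.
apply/ssytP; split=> c d; rewrite !ffunE /= => e l //.
by rewrite e.
Qed.

Lemma content_row_tab : content row_tab = part_mnm n la.
Proof.
apply/mnmP => i; rewrite contentE mnmE -[RHS]subn0.
rewrite -(@card_row la empty_part (fun=> 0%N) (nth 0%N la) i) //.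
  apply: eq_card => c; rewrite !inE ffunE -val_eqE /=.
  by case: eqP => //= <-; have /andP[_ ->] := cell_bounds c.
by rewrite /base nth_nil min0n.
Qed.

(** Let i be the first row where T differs from [row_tab]. An entry is at least its row index, so
    letters below i occur equally often in both tableaux, while i occurs less often in T. *)
Lemma content_lt T : ssyt T -> T != row_tab -> (content T < part_mnm n la)%O.
Proof.
move=> sT neT; rewrite -content_row_tab; have le_row c := row_le_ssyt c sT.
have ex : exists i, [exists c, (cell_row c == i) && (T c != cell_row c :> nat)].
  apply: contrapT => h; case/eqP: neT; apply/ffunP => c; apply: val_inj.
  rewrite ffunE /=; apply/eqP/negPn/negP => ne; apply: h; exists (cell_row c).
  by apply/existsP; exists c; rewrite eqxx.
case: (ex_minnP ex) => i /existsP[c0 /andP[/eqP c0i c0T]] mini.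
have lt_i c : (cell_row c < i)%N -> T c = cell_row c :> nat.
  move=> ci; apply/eqP/negPn/negP => ne.
  have /mini : [exists d, (cell_row d == cell_row c) && (T d != cell_row d :> nat)].
    by apply/existsP; exists c; rewrite eqxx.
  by rewrite leqNgt ci.
have i_n : (i < n)%N by rewrite -c0i row_lt.
apply/ltmcP; first by rewrite !mdeg_content.
exists (Ordinal i_n) => [j ji|]; rewrite !contentE.
  apply: eq_card => c; rewrite !inE ffunE -!val_eqE /=; move: ji => /= ji.
  apply/eqP/eqP => [e|e]; last by rewrite lt_i e.
  by rewrite -e lt_i // (leq_ltn_trans (le_row c)) // e.
apply: proper_card; apply/properP; split.
  apply/subsetP => c; rewrite !inE ffunE -!val_eqE /= => /eqP e.
  have := le_row c; rewrite e leq_eqVlt => /orP[//|l].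
  by have := lt_i c l; rewrite e => E; rewrite E ltnn in l.
exists c0; first by rewrite inE ffunE -val_eqE /= c0i.
by rewrite inE -val_eqE /= -c0i.
Qed.
End SchurLead.

Lemma schur_unitriangular : unitriangular schur.
Proof.
have sz la n T : (size la <= n)%N -> mdeg (@content la n T) = sumn la.
  by move=> h; rewrite mdeg_content -(mdeg_content (row_tab h)) content_row_tab mdeg_part_mnm.
move=> la n; split=> [|lan].
  rewrite schur_content; apply: leq_trans (msize_sum _ _ _) _.
  apply/bigmax_leqP => T _; rewrite msizeX ltnS mdeg_content.
  by rewrite -(mdeg_content (row_tab (leqnn (size la)))) sz.
have cf : (schur la n)@_(part_mnm n la) = 1.
  rewrite schur_content raddf_sum /= (bigD1 (row_tab lan)) ?ssyt_row_tab //=.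
  rewrite mcoeffX content_row_tab eqxx big1 ?addr0 // => T /andP[sT nT].
  by rewrite mcoeffX; case: eqP (content_lt sT nT) => // ->; rewrite ltxx.
split=> //; apply: le_anti; apply/andP; split; last first.
  by apply: msupp_le_mlead; rewrite mcoeff_msupp cf oner_eq0.
rewrite schur_content (le_trans (mlead_sum_le _ _ _)) //.
apply/joins_le => T sT; rewrite mleadXm.
have [->|ne] := eqVneq T (row_tab lan); first by rewrite content_row_tab.
exact/ltW/content_lt.
Qed.

Lemma lift_max_widen n (i : 'I_n) : lift ord_max i = widen_ord (leqnSn n) i.
Proof. by apply: val_inj => /=; rewrite /bump leqNgt ltn_ord. Qed.

Lemma multinom_widen_inj n (m m' : 'X_{1..n.+1}) : m ord_max = m' ord_max ->
  [multinom m (widen_ord (leqnSn n) i) | i < n] =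
  [multinom m' (widen_ord (leqnSn n) i) | i < n] -> m = m'.
Proof.
move=> e /mnmP ek; apply/mnmP => i; have [j ->|->] := unliftP ord_max i => //.
by have := ek j; rewrite !mnmE lift_max_widen.
Qed.

Lemma restrict_mcoeff n (p : {mpoly rat[n.+1]}) (m : 'X_{1..n.+1}) : m ord_max = 0%N ->
  (restrict_poly p)@_[multinom m (widen_ord (leqnSn n) i) | i < n] = p@_m.
Proof.
move=> m0.
have E (k : 'X_{1..n.+1}) :
    \prod_(i < n.+1) (tnth [tuple (if unlift ord_max i is Some j then 'X_j else 0) | i < n.+1] i)
      ^+ k i = (k ord_max == 0%N)%:R *:
    'X_[[multinom k (widen_ord (leqnSn n) i) | i < n]] :> {mpoly rat[n]}.
  rewrite big_ord_recr /= tnth_mktuple unlift_none expr0n mulrC scaler_nat.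
  case: eqP => _; rewrite ?mul0r // mul1r mulr1n [RHS]mpolyXE_id.
  by apply: eq_bigr => i _; rewrite tnth_mktuple -lift_max_widen liftK mnmE lift_max_widen.
rewrite /restrict_poly comp_mpolyE raddf_sum /=.
under eq_bigr do rewrite E scalerA mcoeffZ mcoeffX.
have z (k : 'X_{1..n.+1}) : k != m -> p@_k * (k ord_max == 0%N)%:R *
  ([multinom k (widen_ord (leqnSn n) i) | i < n] ==
     [multinom m (widen_ord (leqnSn n) i) | i < n])%:R = 0.
  move=> ne; case: eqP => [k0|]; last by rewrite mulr0 mul0r.
  case: eqP => [/multinom_widen_inj e|]; last by rewrite mulr0.
  by rewrite e ?k0 ?eqxx in ne.
have [mp|mp] := boolP (m \in msupp p).
  by rewrite (bigD1_seq m) ?msupp_uniq //= big1 // m0 !eqxx !mulr1 addr0.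
rewrite big_seq big1 => [|k kp]; last by apply: z; apply: contraTneq kp => ->.
by apply/esym/eqP; rewrite mcoeff_eq0.
Qed.

(** For more than d variables: if g vanishes once the last variable is set to 0, a nonzero g would
    have a leading monomial containing that variable. The exponents of this monomial decrease by
    symmetry, so it would contain all variables, exceeding the degree bound. *)
Lemma symfun_eq0 (g : symfun) d :
  (forall n, (msize (g n) <= d)%N) -> g d = 0 -> g = 0.
Proof.
move=> gd g0; apply: symfunP => n; rewrite /= mpolyC0.
have [nd|dn] := leqP n d.
  rewrite -(subKn nd); elim: (d - n)%N => [|k IH]; first by rewrite subn0.
  have [kd|dk] := ltnP k d; last by rewrite (_ : (d - k.+1 = d - k)%N) ?IH //; lia.
  have dn m : g m.+1 = 0 -> g m = 0.
    by move=> h; rewrite -sf_restrict h /restrict_poly comp_mpoly0.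
  by apply: dn; rewrite -subSn.
rewrite -(subnKC (ltnW dn)); elim: (n - d)%N => [|k IH]; first by rewrite addn0.
rewrite addnS; apply/eqP/negPn/negP => ne; set m := mlead (g (d + k).+1).
have /negP[] := ne; rewrite -mleadc_eq0 -restrict_mcoeff ?sf_restrict ?IH ?mcoeff0 //.
apply/eqP; rewrite -leqn0 leqNgt; apply/negP => m_gt0.
have := gd (d + k).+1; rewrite -mlead_deg // -/m mdegE => md.
have : (\sum_(i < (d + k).+1) 1 <= \sum_(i < (d + k).+1) m i)%N.
  apply: leq_sum => i _; apply: leq_trans m_gt0 _.
  by apply: mlead_msym_sorted; [apply: sf_sym | apply: leq_ord].
rewrite sum_nat_const card_ord => /leq_ltn_trans/(_ md); lia.
Qed.

Lemma mnm_part n (m : 'X_{1..n}) : (forall i j : 'I_n, (i <= j)%N -> (m j <= m i)%N) ->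
  exists la, (size la <= n)%N /\ part_mnm n la = m.
Proof.
move=> sm; have [||la laE] := @part_exists (nth 0%N m) n.
- move=> i; have [i1n|] := ltnP i.+1 n; last first.
    by move=> h; rewrite nth_default // size_tuple.
  by have := sm (Ordinal (ltnW i1n)) (Ordinal i1n) (leqnSn i); rewrite !(mnm_nth 0%N).
- by rewrite nth_default // size_tuple.
exists la; split.
  rewrite leqNgt; apply/negP => /Defs.part_gt0.
  by rewrite laE nth_default // size_tuple.
by apply/mnmP => i; rewrite mnmE laE (mnm_nth 0%N).
Qed.

(** * Spanning, freeness and linear extension for unitriangular families *)

Section Unitriangular.
Variable b : intpart -> symfun.
Hypothesis bP : unitriangular b.

(** Repeated cancellation of the leading monomial. The bound on the partitions used keeps the degree
    below that of p, so that [unitriangular_span] can pass from d variables to all by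
    [symfun_eq0]. *)
Lemma unitriangular_span_poly n (p : {mpoly rat[n]}) : p \is symmetric ->
  exists2 s : seq (rat * intpart), p = \sum_(x <- s) x.1 *: b x.2 n &
    all (fun x : rat * intpart => (sumn x.2 < msize p)%N) s.
Proof.
elim/mleadrect: p => p IH sp.
have [->|p0] := eqVneq p 0; first by exists [::]; rewrite ?big_nil.
have [la [lan laE]] := mnm_part (mlead_msym_sorted sp).
have [bs /(_ lan)[bl bc]] := bP la n; rewrite laE in bl bc.
have dp : (sumn la).+1 = msize p by rewrite -mlead_deg // -laE mdeg_part_mnm.
pose q := p - p@_(mlead p) *: b la n.
have qs : q \is symmetric by rewrite rpredB ?rpredZ ?sf_sym.
have [q0|q0] := eqVneq q 0.
  exists [:: (p@_(mlead p), la)]; last by rewrite /= -dp ltnSn.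
  by rewrite big_seq1; apply/eqP; rewrite -subr_eq0 -/q q0.
have ql : (mlead q < mlead p)%O.
  rewrite lt_neqAle; apply/andP; split.
    apply: contraNneq q0 => e; rewrite -mleadc_eq0 e /q mcoeffB mcoeffZ bc mulr1.
    by rewrite subrr.
  have := mleadB_le p (p@_(mlead p) *: b la n).
  by rewrite mleadZ ?mleadc_eq0 // bl joinxx.
have [s sE sd] := IH q ql qs.
have qp : (msize q <= msize p)%N by rewrite -!mlead_deg // ltnS lemc_mdeg // ltW.
exists ((p@_(mlead p), la) :: s); first by rewrite big_cons /= -sE addrC subrK.
rewrite /= -dp ltnSn dp; apply: sub_all sd => x h; exact: leq_trans h qp.
Qed.

Lemma unitriangular_span (f : symfun) :
  exists s : seq (rat * intpart), f = \sum_(x <- s) x.1 *: b x.2.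
Proof.
have [d fd] := sf_deg f; have [s fE sd] := unitriangular_span_poly (sf_sym f d).
have evs n : (\sum_(x <- s) x.1 *: b x.2 : symfun) n = \sum_(x <- s) x.1 *: b x.2 n.
  elim: (s) => [|x t IH]; first by rewrite !big_nil /= mpolyC0.
  by rewrite !big_cons -IH.
exists s; apply/eqP; rewrite -subr_eq0; apply/eqP/(@symfun_eq0 _ d) => [n|].
  rewrite [X in msize X](_ : _ = f n - \sum_(x <- s) x.1 *: b x.2 n) -?evs //.
  apply: leq_trans (msizeD_le _ _) _; rewrite msizeN geq_max fd evs.
  apply: leq_trans (msize_sum _ _ _) _; apply/bigmax_leqP_seq => x xs _.
  apply: leq_trans (msizeZ_le _ _) _; have [+ _] := bP x.2 n => /leq_trans; apply.
  exact: leq_trans (allP sd _ xs) (fd d).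
by rewrite [LHS](_ : _ = f d - (\sum_(x <- s) x.1 *: b x.2 : symfun) d) // evs -fE subrr.
Qed.
End Unitriangular.

Lemma sum_partition (V : lmodType rat) (s : seq (rat * intpart)) (c : intpart -> V) :
  \sum_(x <- s) x.1 *: c x.2 =
  \sum_(la <- undup (map snd s)) (\sum_(x <- s | x.2 == la) x.1) *: c la.
Proof.
under [RHS]eq_bigr do rewrite scaler_suml big_mkcond.
rewrite exchange_big /= big_seq [RHS]big_seq; apply: eq_bigr => x xs.
have x2 : x.2 \in undup (map snd s) by rewrite mem_undup map_f.
rewrite (bigD1_seq x.2) ?undup_uniq //= eqxx big1 ?addr0 // => la.
by rewrite eq_sym => /negPf ->.
Qed.

Lemma exists_max (T : eqType) (u : seq T) d (O : orderType d) (f : T -> O) :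
  u != [::] -> exists2 x, x \in u & forall y, y \in u -> (f y <= f x)%O.
Proof.
elim: u => // a u IH _; have [->|/IH[x xu xP]] := eqVneq u [::].
  by exists a; rewrite ?mem_head // => y; rewrite inE => /eqP ->.
have [l|l] := leP (f x) (f a).
  exists a; rewrite ?mem_head // => y; rewrite inE => /predU1P[-> //|/xP].
  by move/le_trans; apply.
exists x; rewrite ?inE ?xu ?orbT // => y; rewrite inE => /predU1P[->|/xP //].
exact: ltW.
Qed.

Lemma part_mnm_inj n la mu : (size la <= n)%N -> (size mu <= n)%N ->
  part_mnm n la = part_mnm n mu -> la = mu.
Proof.
move=> ln mn /mnmP e; apply: part_ext => i; have [il|li] := ltnP i n.
  by have := e (Ordinal il); rewrite !mnmE.
by rewrite !nth_default // (leq_trans _ li).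
Qed.

Section UnitriangularExt.
Variable b : intpart -> symfun.
Hypothesis bP : unitriangular b.

Lemma sum_symfunE (s : seq (rat * intpart)) n :
  (\sum_(x <- s) x.1 *: b x.2 : symfun) n = \sum_(x <- s) x.1 *: b x.2 n.
Proof.
elim: s => [|x t IH]; first by rewrite !big_nil /= mpolyC0.
by rewrite !big_cons -IH.
Qed.

(** In enough variables, the partitions of nonzero total coefficient have distinct leading
    monomials, and the largest of these cannot cancel. Totals are needed since a list may repeat a
    partition. *)
Lemma unitriangular_free (s : seq (rat * intpart)) la :
  \sum_(x <- s) x.1 *: b x.2 = 0 -> \sum_(x <- s | x.2 == la) x.1 = 0.
Proof.
move=> s0; pose m la := \sum_(x <- s | x.2 == la) x.1.
pose u := [seq la <- undup (map snd s) | m la != 0].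
have u0 : u = [::].
  apply/eqP/negPn/negP => nu; pose n := \max_(la <- u) size la.
  have [la0 la0u la0max] := @exists_max _ u _ _ (part_mnm n) nu.
  have sz k : k \in u -> (size k <= n)%N by move=> ku; apply: leq_bigmax_seq.
  have lead k := (bP k n).2.
  have := congr1 (fun f : symfun => (f n)@_(part_mnm n la0)) s0.
  rewrite sum_symfunE (sum_partition s (fun la => b la n)) /= mpolyC0 mcoeff0.
  rewrite (bigID (fun k => k \in u)) /= [X in _ + X]big1_seq => [|k]; last first.
    rewrite mem_filter => /andP[h kt]; move: h; rewrite kt andbT negbK => /eqP.
    by rewrite /m => ->; rewrite scale0r.
  rewrite addr0 raddf_sum /= big_mkcond (bigD1_seq la0) ?undup_uniq //=; last first.
    by move: la0u; rewrite mem_filter => /andP[].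
  rewrite la0u [X in _ + X]big1 => [|k ne]; last first.
    have [ku|//] := boolP (k \in u).
    rewrite mcoeffZ mcoeff_gt_mlead ?mulr0 //.
    have [-> _] := lead k (sz k ku); rewrite lt_neqAle la0max // andbT.
    by apply: contraNneq ne => /part_mnm_inj ->; rewrite ?sz.
  have [_ e1] := lead la0 (sz _ la0u); rewrite addr0 mcoeffZ e1 mulr1 => m0.
  by move: la0u; rewrite mem_filter /m m0 eqxx.
have [lau|lau] := boolP (la \in map snd s).
  apply/eqP/negPn/negP => ml; have : la \in u by rewrite mem_filter ml mem_undup.
  by rewrite u0.
rewrite big1_seq // => x /andP[/eqP e xs].
by rewrite -e map_f in lau.
Qed.

(** [rep] chooses some expression of f in the family; freeness makes the value independent of the
    choice, whence linearity. *)
Lemma unitriangular_ext (V : lmodType rat) (c : intpart -> V) :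
  exists L : {linear symfun -> V}, forall la, L (b la) = c la.
Proof.
pose ev (W : lmodType rat) (d : intpart -> W) (s : seq (rat * intpart)) :=
  \sum_(x <- s) x.1 *: d x.2.
have ev0 s : ev _ b s = 0 -> ev _ c s = 0.
  move=> s0; rewrite /ev sum_partition big1 // => la _.
  by rewrite unitriangular_free ?scale0r.
pose comb a (s t : seq (rat * intpart)) := [seq (a * x.1, x.2) | x <- s] ++ t.
have evC (W : lmodType rat) (d : intpart -> W) a s t :
    ev W d (comb a s t) = a *: ev W d s + ev W d t.
  rewrite /ev big_cat big_map scaler_sumr; congr (_ + _).
  by apply: eq_bigr => x _; rewrite scalerA.
have eqv s t : ev _ b s = ev _ b t -> ev _ c s = ev _ c t.
  move=> e; have /ev0 : ev _ b (comb (-1) s t) = 0 by rewrite evC e scaleN1r addNr.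
  by rewrite evC scaleN1r addrC => /eqP; rewrite subr_eq0 => /eqP.
pose rep f := sval (cid (unitriangular_span bP f)).
have repP f : f = ev _ b (rep f) by exact: (svalP (cid (unitriangular_span bP f))).
pose L f := ev _ c (rep f).
have linL : linear L.
  by move=> a f g; rewrite /L -evC; apply: eqv; rewrite evC -!repP.
exists (HB.pack L (GRing.isLinear.Build rat symfun V *:%R L linL) : {linear symfun -> V}).
by move=> la /=; rewrite /L (eqv _ [:: (1, la)]) /ev ?big_seq1 /= ?scale1r //.
Qed.

Lemma unitriangular_eq (V : lmodType rat) (L L' : {linear symfun -> V}) :
  (forall la, L (b la) = L' (b la)) -> L =1 L'.
Proof.
move=> e f; have [s ->] := unitriangular_span bP f.
by rewrite !linear_sum; apply: eq_bigr => x _; rewrite !linearZ /= e.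
Qed.
End UnitriangularExt.

(** * Evaluation at even and odd letters *)

Definition schur_ext (V : lmodType rat) (c : intpart -> V) : {linear symfun -> V} :=
  sval (cid (unitriangular_ext schur_unitriangular c)).

Lemma schur_extE (V : lmodType rat) (c : intpart -> V) la :
  schur_ext c (schur la) = c la.
Proof. exact: (svalP (cid (unitriangular_ext schur_unitriangular c))). Qed.

(** The operation f(v) -> f(v, w): the letters of w fill the outer part la/mu, and mu is left to the
    variables. *)
Definition skew_by w : {linear symfun -> symfun} :=
  schur_ext (fun la => \sum_(mu <- subparts la) wsum w la mu *: schur mu).

(* The hook Schur functions with the letters of w, extended linearly. *)
Definition hook_eval w : {linear symfun -> rat^o} :=
  schur_ext (fun la => wsum w la empty_part : rat^o).

Lemma skew_by_schur w la :
  skew_by w (schur la) = \sum_(mu <- subparts la) wsum w la mu *: schur mu.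
Proof. exact: schur_extE. Qed.

Lemma hook_eval_schur w la : hook_eval w (schur la) = wsum w la empty_part.
Proof. exact: schur_extE. Qed.

Lemma schur_eq (V : lmodType rat) (L L' : {linear symfun -> V}) :
  (forall la, L (schur la) = L' (schur la)) -> L =1 L'.
Proof. exact: (unitriangular_eq schur_unitriangular). Qed.

Lemma skew_by_cat w1 w2 f : skew_by (w1 ++ w2) f = skew_by w2 (skew_by w1 f).
Proof.
move: f; apply: (schur_eq (L' := skew_by w2 \o skew_by w1)) => la /=.
rewrite !skew_by_schur linear_sum /=.
under eq_bigr do rewrite wsum_cat scaler_suml.
rewrite exchange_big /= big_seq [RHS]big_seq; apply: eq_bigr => nu.
rewrite mem_subparts => nl; rewrite linearZ /= skew_by_schur scaler_sumr.
rewrite (big_subparts nl) => [|mu h]; last by rewrite (wsum_eq0 w2 h) scale0r scaler0.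
by apply: eq_bigr => mu _; rewrite scalerA.
Qed.

Lemma hook_eval_cat w1 w2 f : hook_eval (w1 ++ w2) f = hook_eval w2 (skew_by w1 f).
Proof.
move: f; apply: (schur_eq (L' := hook_eval w2 \o skew_by w1)) => la /=.
rewrite hook_eval_schur wsum_cat skew_by_schur linear_sum /=.
by apply: eq_bigr => nu _; rewrite linearZ /= hook_eval_schur.
Qed.

Lemma skew_by_id w : (forall la mu, wsum w la mu = (la == mu)%:R) -> skew_by w =1 id.
Proof.
move=> h f; apply: (schur_eq (L' := idfun)) => la; rewrite skew_by_schur.
rewrite (big_subparts1 (included_refl la)) => [|mu]; rewrite h.
  by rewrite eqxx scale1r.
by rewrite eq_sym => /negPf ->; rewrite scale0r.
Qed.

Lemma meval_symfun n (u : nat -> rat) (f : symfun) :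
  (f n).@[fun i => u i] = hook_eval (letters (fun=> false) u n) f.
Proof.
have [s ->] := unitriangular_span schur_unitriangular f.
rewrite sum_symfunE linear_sum raddf_sum /=; apply: eq_bigr => x _.
by rewrite mevalZ schur_meval linearZ /= hook_eval_schur.
Qed.

Lemma subparts_empty : subparts empty_part = [:: empty_part].
Proof.
apply: perm_small_eq => //; apply: uniq_perm => //; first exact: subparts_uniq.
move=> mu; rewrite mem_subparts inE; apply/includedP/eqP => [nl|-> i //].
by apply: part_ext => i; apply/eqP; rewrite nth_nil -leqn0 (leq_trans (nl i)) // nth_nil.
Qed.

Lemma wsum_empty w : wsum w empty_part empty_part = 1.
Proof.
elim: w => [|[b x] w IH]; first by [].
rewrite [LHS](_ : _ = \sum_(nu <- subparts empty_part | strip b empty_part nu)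
  x ^+ (sumn empty_part - sumn nu) * wsum w nu empty_part) // subparts_empty.
by rewrite big_mkcond big_seq1 /= IH mulr1.
Qed.

Lemma schur_empty : schur empty_part = 1.
Proof.
apply: symfun_eq => n u; rewrite meval_symfun hook_eval_schur wsum_empty.
by rewrite /= mevalC.
Qed.

Lemma skew_by1 w : skew_by w 1 = 1.
Proof.
by rewrite -schur_empty skew_by_schur subparts_empty big_seq1 wsum_empty scale1r.
Qed.

Lemma hook_eval1 w : hook_eval w 1 = 1.
Proof. by rewrite -schur_empty hook_eval_schur wsum_empty. Qed.

(** The removed letter plays the role of the last variable; hence [skew_by] for one even letter is a
    substitution, which respects products. *)
Lemma meval_skew_by_even n (u : nat -> rat) c (f : symfun) :
  (skew_by [:: (false, c)] f n).@[fun i => u i] =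
  (f n.+1).@[fun i => if (i < n)%N then u i else c].
Proof.
rewrite meval_symfun -hook_eval_cat.
rewrite (meval_symfun n.+1 (fun i => if (i < n)%N then u i else c)) /= ltnn.
congr (hook_eval (_ :: _) f); apply: eq_letters => // i l.
by rewrite l.
Qed.

Lemma skew_by_evenM c : {morph skew_by [:: (false, c)] : f g / f * g}.
Proof.
move=> f g; apply: symfun_eq => n u.
by rewrite sf_mulE mevalM !meval_skew_by_even sf_mulE mevalM.
Qed.

Lemma skew_by_oddK c : cancel (skew_by [:: (true, c)]) (skew_by [:: (false, - c)]).
Proof. by move=> f; rewrite -skew_by_cat skew_by_id // => la mu; apply: wsum_cancel. Qed.

Lemma skew_by_evenK c : cancel (skew_by [:: (false, - c)]) (skew_by [:: (true, c)]).
Proof.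
move=> f; rewrite -skew_by_cat skew_by_id // => la mu.
(* Conjugation exchanges the parities, turning the reversed order of the two letters into the
   cancellation for -c. *)
rewrite -wsum_conj; have := wsum_cancel (- c) (conj_part la) (conj_part mu).
by rewrite opprK (inj_eq (can_inj conj_partK)).
Qed.

Lemma skew_byM w : {morph skew_by w : f g / f * g}.
Proof.
elim: w => [|[b c] w IH] f g; first by rewrite !skew_by_id.
rewrite -[(b, c) :: w]cat1s !skew_by_cat -IH; congr (skew_by w _).
case: b; last exact: skew_by_evenM.
by rewrite -{1}(skew_by_oddK c f) -{1}(skew_by_oddK c g) -skew_by_evenM skew_by_evenK.
Qed.

Lemma hook_evalZ w a f : hook_eval w (a *: f) = a * hook_eval w f :> rat.
Proof. by rewrite linearZ. Qed.

(** Once all letters are removed by [skew_by], what remains is evaluation in zero variables, a ring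
    morphism. *)
Lemma hook_evalM w f g : hook_eval w (f * g) = hook_eval w f * hook_eval w g :> rat.
Proof.
rewrite -[w]cats0 !hook_eval_cat skew_byM.
by rewrite -!(meval_symfun 0 (fun=> 0)) sf_mulE mevalM.
Qed.

(** * Power sums *)

Definition power_sum_poly k n : {mpoly rat[n]} := \sum_(i < n) 'X_i ^+ k.+1.

Lemma power_sum_sym k n : power_sum_poly k n \is symmetric.
Proof.
apply/issymP => s; rewrite raddf_sum /= [RHS](reindex_inj (@perm_inj _ s)) /=.
apply: eq_bigr => i _; rewrite rmorphXn /= msymX; congr ('X_[_] ^+ _).
apply/mnmP => j; rewrite !mnmE; congr (nat_of_bool _).
by rewrite (can2_eq (permK s) (permKV s)).
Qed.

Lemma power_sum_restrict k n :
  restrict_poly (power_sum_poly k n.+1) = power_sum_poly k n.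
Proof.
rewrite /restrict_poly raddf_sum big_ord_recr /= rmorphXn /= comp_mpolyXU.
rewrite -tnth_nth tnth_mktuple unlift_none expr0n addr0; apply: eq_bigr => i _.
by rewrite rmorphXn /= comp_mpolyXU -tnth_nth tnth_mktuple -lift_max_widen liftK.
Qed.

Lemma power_sum_deg k : exists d, forall n, (msize (power_sum_poly k n) <= d)%N.
Proof.
exists k.+2 => n; apply: leq_trans (msize_sum _ _ _) _; apply/bigmax_leqP => i _.
by rewrite mpolyXn msizeX mdegMn mdeg1 mul1n.
Qed.

(* power_sum k is the power sum of exponent k + 1. *)
Definition power_sum k : symfun :=
  SymFun (power_sum_sym k) (power_sum_restrict k) (power_sum_deg k).

Lemma meval_power_sum k n (u : nat -> rat) :
  (power_sum k n).@[fun i => u i] = \sum_(i < n) u i ^+ k.+1.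
Proof.
by rewrite /= raddf_sum; apply: eq_bigr => i _; rewrite /= rmorphXn /= mevalXU.
Qed.

Lemma skew_by_even_power_sum c k :
  skew_by [:: (false, c)] (power_sum k) = power_sum k + c ^+ k.+1 *: 1.
Proof.
apply: symfun_eq => n u; rewrite meval_skew_by_even sf_addE mevalD meval_power_sum.
rewrite (meval_power_sum k n.+1 (fun i => if (i < n)%N then u i else c)) sf_scaleE.
rewrite mevalZ mevalC mulr1 big_ord_recr /= ltnn; congr (_ + _).
by apply: eq_bigr => i _; rewrite ltn_ord.
Qed.

Lemma skew_by_odd_power_sum c k :
  skew_by [:: (true, c)] (power_sum k) = power_sum k - (- c) ^+ k.+1 *: 1.
Proof.
apply: (can_inj (skew_by_evenK c)).
by rewrite skew_by_oddK linearB linearZ /= skew_by1 skew_by_even_power_sum addrK.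
Qed.

Definition letter_power k (x : bool * rat) : rat :=
  if x.1 then - (- x.2) ^+ k.+1 else x.2 ^+ k.+1.

Lemma hook_eval_power_sum w k :
  hook_eval w (power_sum k) = \sum_(x <- w) letter_power k x :> rat.
Proof.
elim: w => [|[b c] w IH].
  by rewrite big_nil -(meval_symfun 0 (fun=> 0)) (meval_power_sum k 0 (fun=> 0)) big_ord0.
rewrite -cat1s hook_eval_cat big_cat big_seq1 -IH /=.
have h d : hook_eval w (d *: 1) = d by rewrite linearZ /= hook_eval1 [LHS]mulr1.
case: b; rewrite ?skew_by_odd_power_sum ?skew_by_even_power_sum /letter_power /=.
  by rewrite linearB /= h addrC.
by rewrite linearD /= h addrC.
Qed.

(** * Elementary symmetric functions and Newton's identities *)

Fact col_subproof k : sorted geq (nseq k 1%N) && (0%N \notin nseq k 1%N).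
Proof.
rewrite mem_nseq andbF andbT; elim: k => //= -[|k] //=.
Qed.
Definition col_part k : intpart := IntPart (col_subproof k).

Lemma nth_col_part k i : nth 0%N (col_part k) i = (i < k)%N.
Proof. by rewrite nth_nseq; case: ifP. Qed.

Definition elem_sym k : symfun := schur (col_part k).

Lemma skew_by_letter b x la : skew_by [:: (b, x)] (schur la) =
  \sum_(mu <- subparts la | strip b la mu) x ^+ (sumn la - sumn mu) *: schur mu.
Proof.
rewrite skew_by_schur [RHS]big_mkcond big_seq [RHS]big_seq; apply: eq_bigr => mu.
rewrite mem_subparts => ml.
rewrite [wsum _ _ _](_ : _ = \sum_(nu <- subparts la)
  (if strip b la nu then x ^+ (sumn la - sumn nu) * (nu == mu)%:R else 0)); last first.
  exact: big_mkcond.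
rewrite (big_subparts1 ml) => [|nu /negPf ->]; last by rewrite mulr0 if_same.
by rewrite eqxx mulr1; case: ifP; rewrite ?scale0r.
Qed.

(** A horizontal strip can take from a column at most its bottom box. *)
Lemma skew_by_even_elem_sym c k :
  skew_by [:: (false, c)] (elem_sym k.+1) = elem_sym k.+1 + c *: elem_sym k.
Proof.
have kk : included (col_part k) (col_part k.+1).
  by apply/includedP => i; rewrite !nth_col_part; lia.
have ne : col_part k != col_part k.+1.
  by apply/eqP => /(congr1 (fun la : intpart => size la)); rewrite !size_nseq; lia.
have sub nu : included nu (col_part k.+1) -> strip false (col_part k.+1) nu ->
    nu = col_part k \/ nu = col_part k.+1.
  move=> /includedP h1 /stripP h2; have h i := h1 i; have h' i := h2 i.
  have [e|e] : nth 0%N nu k = 0%N \/ nth 0%N nu k = 1%N.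
  - by have := h k; rewrite nth_col_part; lia.
  - left; apply: part_ext => i; have := h i; have := h' i.
    rewrite !nth_col_part; have [ik|ki] := leqP k i; last by lia.
    by have := part_geq nu ik; lia.
  - right; apply: part_ext => i; have := h i; have := h' i.
    rewrite !nth_col_part; have [ik|ki] := leqP i k; last by lia.
    by have := part_geq nu ik; lia.
rewrite skew_by_letter -big_filter (perm_big [:: col_part k.+1; col_part k]).
  by rewrite big_cons big_seq1 !sumn_nseq subnn expr0 scale1r !mul1n subSnn expr1.
apply: uniq_perm; first exact/filter_uniq/subparts_uniq.
  by rewrite /= inE eq_sym ne.
move=> nu; rewrite mem_filter mem_subparts !inE.
apply/andP/orP => [[h1 h2]|[]/eqP ->].
- by have [->|->] := sub nu h2 h1; rewrite eqxx; [right|left].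
- by split; [apply/stripP => i; apply: part_geq|apply: included_refl].
- by split=> //; apply/stripP => i; rewrite !nth_col_part.
Qed.

Lemma elem_sym0 : elem_sym 0 = 1.
Proof. by rewrite -schur_empty; congr schur; apply: val_inj. Qed.

(** A new variable c multiplies E(t) by 1 + c t and adds c^(i+1) to the power sum of that exponent.
    The right side then splits into the old sum in degree k + 1, c times the old sum in degree k,
    and a remainder involving only E and powers of c. *)
Lemma newton_step (c : rat) (E E' P P' : nat -> rat) :
  E' 0%N = E 0%N -> (forall k, E' k.+1 = E k.+1 + c * E k) ->
  (forall i, P' i = P i + c ^+ i.+1) ->
  (forall k, k.+1%:R * E k.+1 = \sum_(i < k.+1) (-1) ^+ i * (E (k - i)%N * P i)) ->
  forall k, k.+1%:R * E' k.+1 = \sum_(i < k.+1) (-1) ^+ i * (E' (k - i)%N * P' i).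
Proof.
move=> E0 ES PS N k.
(* The remainder telescopes: its term i is a_i - a_(i+1) with a_i = (-1)^i E_(k-i) c^(i+1). *)
have T m : (m <= k)%N -> \sum_(i < m) (-1) ^+ i *
    (E (k - i)%N * c ^+ i.+1 + c * E (k - i.+1)%N * c ^+ i.+1) =
    c * E k - (-1) ^+ m * (E (k - m)%N * c ^+ m.+1).
  elim: m => [|m IH] mk; first by rewrite big_ord0 subn0; ring.
  by rewrite big_ord_recr /= IH ?(ltnW mk) // !exprS; ring.
have Nk : k%:R * E k = \sum_(i < k) (-1) ^+ i * (E (k - i.+1)%N * P i).
  case: {+}k => [|k']; first by rewrite big_ord0 mul0r.
  by rewrite N; apply: eq_bigr => i _; rewrite subSS.
have NSk := N k; rewrite big_ord_recr /= subnn in NSk.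
rewrite big_ord_recr /= subnn E0 ES PS.
rewrite (eq_bigr (fun i : 'I_k => (-1) ^+ i * (E (k - i)%N * P i) +
    c * ((-1) ^+ i * (E (k - i.+1)%N * P i)) +
    (-1) ^+ i * (E (k - i)%N * c ^+ i.+1 + c * E (k - i.+1)%N * c ^+ i.+1))).
  rewrite 2!big_split /= T // -mulr_sumr -Nk subnn mulrDr NSk.
  by rewrite -[k.+1%:R]natr1; ring.
by move=> i _; rewrite PS (_ : (k - i = (k - i.+1).+1)%N) ?ES; [ring|have := ltn_ord i; lia].
Qed.

Lemma newton k : k.+1%:R *: elem_sym k.+1 =
  \sum_(i < k.+1) (-1) ^+ i *: (elem_sym (k - i) * power_sum i).
Proof.
apply: symfun_eq => n u; rewrite !meval_symfun hook_evalZ linear_sum /=.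
under eq_bigr do rewrite hook_evalZ hook_evalM.
have [w ->] : exists w, letters (fun=> false) u n = [seq (false, x) | x <- w].
  by exists (rev (mkseq u n)); elim: n => // n IH; rewrite mkseqS rev_rcons /= IH.
elim: w k => [|c w IH] k.
  rewrite [LHS](_ : _ = 0) ?big1 // => [i _|].
    by rewrite hook_eval_power_sum big_nil !mulr0.
  by rewrite hook_eval_schur [X in _ * X](_ : _ = 0) ?mulr0.
have E f : hook_eval [seq (false, x) | x <- c :: w] f =
    hook_eval [seq (false, x) | x <- w] (skew_by [:: (false, c)] f).
  by rewrite -hook_eval_cat.
pose ev v f : rat := hook_eval [seq (false, x) | x <- v] f.
apply: (@newton_step c (fun k => ev w (elem_sym k)) (fun k => ev (c :: w) (elem_sym k))
  (fun k => ev w (power_sum k)) (fun k => ev (c :: w) (power_sum k))) => //.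
- by rewrite /ev elem_sym0 !hook_eval1.
- by move=> i; rewrite /ev E skew_by_even_elem_sym linearD /= hook_evalZ.
- by move=> i; rewrite /ev E skew_by_even_power_sum linearD /= hook_evalZ hook_eval1 mulr1.
Qed.

(** The product over the columns of la, since e_j has leading monomial x_1...x_j and the product
    then has leading monomial x^la. *)
Definition elem_sym_prod la : symfun := \prod_(j <- conj_part la) elem_sym j.

Lemma prod_symfunE (I : Type) (s : seq I) (F : I -> symfun) n :
  (\prod_(i <- s) F i : symfun) n = \prod_(i <- s) F i n.
Proof.
elim: s => [|i s IH]; first by rewrite !big_nil /= mpolyC1.
by rewrite !big_cons sf_mulE IH.
Qed.

Lemma msize_prod_le n (s : seq nat) (F : nat -> {mpoly rat[n]}) :
  (forall j, (msize (F j) <= j.+1)%N) ->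
  (msize (\prod_(j <- s) F j) <= (sumn s).+1)%N.
Proof.
move=> hF; elim: s => [|j s IH]; first by rewrite big_nil msize1.
rewrite big_cons /=; have [->|n0] := eqVneq (F j) 0; first by rewrite mul0r msize0.
have [->|n1] := eqVneq (\prod_(i <- s) F i) 0; first by rewrite mulr0 msize0.
rewrite msizeM // -subn1 leq_subLR; apply: leq_trans (leq_add (hF j) IH) _.
by rewrite addSn addnS.
Qed.

Lemma sumn_col_part j : sumn (col_part j) = j.
Proof. by rewrite sumn_nseq mul1n. Qed.

Lemma elem_sym_prod_unitriangular : unitriangular elem_sym_prod.
Proof.
move=> la n; rewrite /elem_sym_prod prod_symfunE; split.
  rewrite -sumn_conj; apply: msize_prod_le => j.
  by have [] := schur_unitriangular (col_part j) n; rewrite sumn_col_part.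
move=> lan; have lead j : j \in Defs.pval (conj_part la) ->
    mlead (elem_sym j n) = part_mnm n (col_part j) /\ mleadc (elem_sym j n) = 1.
  move=> jla; have [_ h] := schur_unitriangular (col_part j) n.
  have [|e1 e2] := h; last by rewrite e1.
  rewrite size_nseq (leq_trans _ lan) //.
  by case/(nthP 0%N): jla => i _ <-; rewrite nth_conj count_size.
have lead1 : \prod_(j <- conj_part la) mleadc (elem_sym j n) = 1.
  by rewrite big_seq big1 // => j /lead[].
have sumE : (\sum_(j <- conj_part la) mlead (elem_sym j n))%MM = part_mnm n la.
  rewrite big_seq (eq_bigr (fun j => part_mnm n (col_part j))) => [|j /lead[]//].
  rewrite -big_seq; apply/mnmP => i; rewrite mnm_sumE mnmE -[in RHS](conj_partK la) nth_conj.
  rewrite -sum1_count [RHS]big_mkcond /=; apply: eq_bigr => j _.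
  by rewrite mnmE nth_col_part; case: ifP.
rewrite mlead_prod => [|j jla _]; last first.
  by rewrite -mleadc_eq0; have [_ ->] := lead j jla; rewrite oner_eq0.
by rewrite sumE; split=> //; rewrite -sumE mleadc_prod lead1.
Qed.

(** Newton's identities divided by k + 1 produce the elementary functions, whose products span. *)
Lemma power_sum_ind (P : symfun -> Prop) :
  P 1 -> (forall a f g, P f -> P g -> P (a *: f + g)) ->
  (forall f g, P f -> P g -> P (f * g)) -> (forall k, P (power_sum k)) ->
  forall f, P f.
Proof.
move=> P1 PL PM PS f.
have P0 : P 0 by rewrite -(addNr 1) -scaleN1r; apply: PL.
have PZ a g : P g -> P (a *: g) by move=> Pg; rewrite -[_ *: _]addr0; apply: PL.
have PSum I (s : seq I) (F : I -> symfun) : (forall i, P (F i)) -> P (\sum_(i <- s) F i).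
  move=> h; elim: s => [|i s IH]; first by rewrite big_nil.
  by rewrite big_cons -[F i]scale1r; apply: PL.
have PE k : P (elem_sym k).
  elim/ltn_ind: k => -[_|k IH]; first by rewrite elem_sym0.
  rewrite -[elem_sym _]scale1r -(@mulVf _ k.+1%:R) ?Num.Theory.pnatr_eq0 //.
  rewrite -scalerA newton; apply/PZ/PSum => i; apply/PZ/PM => //.
  by apply: IH; rewrite ltnS leq_subr.
have [s ->] := unitriangular_span elem_sym_prod_unitriangular f.
apply: PSum => x; apply: PZ; rewrite /elem_sym_prod.
by elim: (Defs.pval _) => [|j t IH]; rewrite ?big_nil // big_cons; apply: PM.
Qed.

(** * The map D *)

Lemma hook_eval_ext w w' :
  (forall k, hook_eval w (power_sum k) = hook_eval w' (power_sum k)) ->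
  hook_eval w =1 hook_eval w'.
Proof.
move=> h; apply: power_sum_ind => [|a f g Ef Eg|f g Ef Eg|//].
- by rewrite !hook_eval1.
- by rewrite !linearD /= !hook_evalZ Ef Eg.
- by rewrite !hook_evalM Ef Eg.
Qed.

(** The chains of strips depend on the order of the letters, but the values of power sums do not. *)
Lemma hook_eval_perm w w' : perm_eq w w' -> hook_eval w =1 hook_eval w'.
Proof.
by move=> h; apply: hook_eval_ext => k; rewrite !hook_eval_power_sum (perm_big _ h).
Qed.

Definition monochrome (b : bool) (v : seq rat) : seq (bool * rat) := [seq (b, x) | x <- v].

Lemma monochrome_letters v : exists n (u : nat -> rat),
  forall b, monochrome b v = letters (fun=> b) u n.
Proof.
elim: v => [|x v [n [u IH]]]; first by exists 0%N, (fun=> 0).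
exists n.+1, (fun i => if (i < n)%N then u i else x) => b.
rewrite /= ltnn IH; congr (_ :: _); apply: eq_letters => // i l.
by rewrite l.
Qed.

Lemma letters_monochrome (u : nat -> rat) n : exists v,
  forall b, letters (fun=> b) u n = monochrome b v.
Proof.
elim: n => [|n [v IH]]; first by exists [::].
by exists (u n :: v) => b /=; rewrite IH.
Qed.

Lemma hook_eval_even_inj (f g : symfun) :
  (forall v, hook_eval (monochrome false v) f = hook_eval (monochrome false v) g) -> f = g.
Proof.
move=> h; apply: symfun_eq => n u; rewrite !meval_symfun.
by have [v ->] := letters_monochrome u n.
Qed.

Lemma conj_empty : conj_part empty_part = empty_part.
Proof. exact: val_inj. Qed.

Lemma hook_eval_schur_conj w la :
  hook_eval w (schur (conj_part la)) = hook_eval [seq (~~ p.1, p.2) | p <- w] (schur la).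
Proof.
rewrite !hook_eval_schur -wsum_conj conj_partK conj_empty; congr wsum.
Qed.

Lemma letter_power_parity b k x : letter_power k (b, x) = (-1) ^+ (b * k) * x ^+ k.+1.
Proof.
rewrite /letter_power; case: b; rewrite /= ?mul1n ?mul0n ?expr0 ?mul1r //.
by rewrite (exprNn x) exprS mulN1r mulNr opprK.
Qed.

(** * Double symmetry through evaluations *)

Lemma schur_span_fsfun (f : symfun) : exists m : {fsfun intpart -> rat with 0},
  f = \sum_(la <- finsupp m) m la *: schur la.
Proof.
have [s ->] := unitriangular_span schur_unitriangular f.
pose t := undup (map snd s).
pose m : {fsfun intpart -> rat with 0} :=
  [fsfun la in [fset la | la in t]%fset => \sum_(x <- s | x.2 == la) x.1 | 0].
have mE la : la \in t -> m la = \sum_(x <- s | x.2 == la) x.1.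
  by move=> h; rewrite fsfunE inE /= h.
exists m; rewrite sum_partition big_seq (eq_bigr (fun la => m la *: schur la)); last first.
  by move=> la /mE ->.
rewrite -big_seq (bigID (fun la => la \in finsupp m)) /= [X in _ + X]big1 ?addr0.
  rewrite -big_filter; apply: perm_big; apply: uniq_perm.
  - exact/filter_uniq/undup_uniq.
  - exact: fset_uniq.
  move=> la; rewrite mem_filter andb_idr // mem_finsupp fsfunE inE /=.
  by case: ifP => //; rewrite eqxx.
by move=> la; rewrite memNfinsupp => /eqP ->; rewrite scale0r.
Qed.

(** [hook_eval] absorbs the coefficients m, and a polynomial identity amounts to equality at all
    rational points. *)
Lemma doubly_symmetricP (g : symfun) : doubly_symmetric g <->
  forall k l u, hook_eval (letters (fun i => (k <= i)%N) u (k + l)) g =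
                hook_eval (letters (fun=> false) u (k + l)) g.
Proof.
have lhs (m : {fsfun intpart -> rat with 0}) n (u : nat -> rat) :
    (\sum_(la <- finsupp m) m la *: schur la n).@[fun i => u i] =
    hook_eval (letters (fun=> false) u n) (\sum_(la <- finsupp m) m la *: schur la).
  rewrite linear_sum raddf_sum; apply: eq_bigr => la _ /=.
  by rewrite mevalZ hook_evalZ -meval_symfun.
have rhs (m : {fsfun intpart -> rat with 0}) k l (u : nat -> rat) :
    (\sum_(la <- finsupp m) m la *: hook_schur k l la).@[fun i => u i] =
    hook_eval (letters (fun i => (k <= i)%N) u (k + l))
      (\sum_(la <- finsupp m) m la *: schur la).
  rewrite linear_sum raddf_sum; apply: eq_bigr => la _ /=.
  by rewrite mevalZ hook_evalZ hook_schur_meval hook_eval_schur.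
split=> [[m [-> h]] k l u|h]; first by rewrite -rhs -lhs h.
have [m gm] := schur_span_fsfun g; exists m; split=> // k l.
apply/eqP; rewrite -subr_eq0; apply/eqP/mpoly_eq0_meval => u.
by rewrite mevalB lhs rhs -gm h subrr.
Qed.

Lemma doubly_symmetric_double (g : symfun) v : doubly_symmetric g ->
  hook_eval (monochrome true v ++ monochrome false v) g =
  hook_eval (monochrome false v ++ monochrome false v) g.
Proof.
move=> /doubly_symmetricP h; have [n [u E]] := monochrome_letters v.
(* Take k = l = n and give the primed variables the same values as the unprimed ones. *)
pose u' i := if (i < n)%N then u i else u (i - n)%N.
have low ty m : (m <= n)%N -> (forall i, (i < n)%N -> ty i = false) ->
    letters ty u' m = letters (fun=> false) u m.
  move=> mn tyn; apply: eq_letters => i /leq_trans/(_ mn) l; first exact: tyn.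
  by rewrite /u' l.
have cat ty b m : (forall i, (i < n)%N -> ty i = false) ->
    (forall i, (n <= i)%N -> ty i = b) ->
    letters ty u' (n + m) = letters (fun=> b) u m ++ letters (fun=> false) u n.
  move=> h1 h2; elim: m => [|m IH]; first by rewrite addn0 low.
  rewrite addnS /= IH h2 ?leq_addr // /u' ltnNge leq_addr /=.
  by rewrite addKn.
have := h n n u'; rewrite (cat _ true) ?(cat _ false) -?E //.
by move=> i; rewrite ltnNge => /negPf.
Qed.

(** A power sum at m copies of w is m times its value at w, and polynomial dependence on m survives
    sums and products. *)
Lemma hook_eval_nseq_poly (f : symfun) w : exists q : {poly rat},
  forall m, hook_eval (flatten (nseq m w)) f = q.[m%:R].
Proof.
move: f; apply: power_sum_ind => [|a f g [p Ep] [q Eq]|f g [p Ep] [q Eq]|k].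
- by exists 1 => m; rewrite hook_eval1 hornerE.
- by exists (a *: p + q) => m; rewrite linearD /= hook_evalZ Ep Eq !hornerE.
- by exists (p * q) => m; rewrite hook_evalM Ep Eq hornerM.
exists (hook_eval w (power_sum k) *: 'X) => m; rewrite hornerZ hornerX.
rewrite !hook_eval_power_sum; elim: m => [|m IH]; first by rewrite big_nil mulr0.
by rewrite /= big_cat IH -natr1 mulrDr mulr1 addrC.
Qed.

(* Replacing v by 2m copies of itself turns the hypothesis into the vanishing of a
   polynomial in m. *)
Lemma hook_eval_double_inj (f : symfun) :
  (forall v, hook_eval (monochrome false v ++ monochrome false v) f = 0) -> f = 0.
Proof.
move=> h; apply: hook_eval_even_inj => v; rewrite linear0.
have [q qE] := hook_eval_nseq_poly f (monochrome false v).
have q0 : q = 0.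
  apply: (@poly_eq0_nat _ _ (fun m => (m + m)%:R)) => [a b /natr_rat_inj|m]; first by lia.
  rewrite -qE nseqD flatten_cat.
  have -> : flatten (nseq m (monochrome false v)) = monochrome false (flatten (nseq m v)).
    by rewrite /monochrome map_flatten map_nseq.
  exact: h.
(* The value at v itself is the one at m = 1, outside the even points used to show q = 0. *)
by have := qE 1%N; rewrite q0 horner0 /= cats0.
Qed.

(** * The ideal of conjugation differences *)

Section IdealGen.
Variables (R : comNzRingType) (G : R -> Prop).
Local Notation I := (in_ideal_gen G).

Lemma ideal_gen0 : I 0.
Proof. by exists [::] => //; rewrite big_nil. Qed.

Lemma ideal_gen_incl g : G g -> I g.
Proof.
move=> Gg; exists [:: (1, g)]; last by rewrite big_seq1 mul1r.
by move=> p; rewrite inE => /eqP ->.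
Qed.

Lemma ideal_genD f g : I f -> I g -> I (f + g).
Proof.
move=> [s Gs ->] [t Gt ->]; exists (s ++ t); last by rewrite big_cat.
by move=> p; rewrite mem_cat => /orP[/Gs|/Gt].
Qed.

Lemma ideal_genMl a f : I f -> I (a * f).
Proof.
move=> [s Gs ->]; exists [seq (a * p.1, p.2) | p <- s].
  by move=> _ /mapP[p /Gs h ->].
by rewrite big_map mulr_sumr; apply: eq_bigr => p _; rewrite mulrA.
Qed.
End IdealGen.

Definition schur_conj_diff (h : symfun) : Prop :=
  exists la : intpart, h = schur la - schur (conj_part la).

Lemma ideal_genZ (G : symfun -> Prop) a f : in_ideal_gen G f -> in_ideal_gen G (a *: f).
Proof. by move=> h; rewrite -[f]mul1r scalerAl; apply: ideal_genMl. Qed.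

(* When k is odd, the conjugation S_la |-> S_la' maps power_sum k to its opposite. *)
Lemma even_power_sum_ideal k : odd k -> in_ideal_gen schur_conj_diff (power_sum k).
Proof.
move=> ok; have [s sE] := unitriangular_span schur_unitriangular (power_sum k).
pose p' : symfun := \sum_(x <- s) x.1 *: schur (conj_part x.2).
have p'E : p' = - power_sum k.
  apply: hook_eval_even_inj => v; rewrite linearN.
  have -> : hook_eval (monochrome false v) p' = hook_eval (monochrome true v) (power_sum k).
    rewrite sE !linear_sum; apply: eq_bigr => x _; rewrite /= !hook_evalZ.
    by rewrite hook_eval_schur_conj /monochrome -map_comp.
  rewrite !hook_eval_power_sum !big_map -sumrN; apply: eq_bigr => x _.
  by rewrite !letter_power_parity mul1n mul0n expr0 mul1r -signr_odd ok mulN1r.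
(* Since p' = -p for the power sum p, 2 p = p - p' is a linear combination of generators. *)
rewrite -[power_sum k]scale1r -(@mulVf _ 2%:R) // -scalerA; apply: ideal_genZ.
rewrite scaler_nat mulr2n -{2}[power_sum k]opprK -p'E sE -sumrB.
elim: (s) => [|x t IH]; first by rewrite big_nil; apply: ideal_gen0.
rewrite big_cons -scalerBr; apply: ideal_genD => //; apply/ideal_genZ/ideal_gen_incl.
by exists x.2.
Qed.

(** * Properties of any linear map with the prescribed values on Schur functions *)

Section MapD.
Variable D : {linear symfun -> symfun}.
Hypothesis DE : forall la, D (schur la) =
  \sum_(mu <- subparts la) schur mu * skew_schur (conj_part la) (conj_part mu).

Lemma hook_eval_D v f : hook_eval (monochrome false v) (D f) =
  hook_eval (monochrome true v ++ monochrome false v) f.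
Proof.
move: f; apply: (schur_eq (L := hook_eval (monochrome false v) \o D)) => la /=.
have [n [u vE]] := monochrome_letters v.
rewrite DE linear_sum hook_eval_schur wsum_cat big_seq [RHS]big_seq.
apply: eq_bigr => mu; rewrite mem_subparts => ml /=.
by rewrite hook_evalM hook_eval_schur mulrC !vE -meval_symfun skew_schur_conj_meval.
Qed.

Lemma D1 : D 1 = 1.
Proof. by apply: hook_eval_even_inj => v; rewrite hook_eval_D !hook_eval1. Qed.

Lemma DM : {morph D : f g / f * g}.
Proof.
move=> f g; apply: hook_eval_even_inj => v.
by rewrite hook_evalM !hook_eval_D hook_evalM.
Qed.

Lemma D_power_sum k : D (power_sum k) = (1 + (-1) ^+ k) *: power_sum k.
Proof.
apply: hook_eval_even_inj => v; rewrite hook_eval_D hook_evalZ !hook_eval_power_sum.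
rewrite big_cat !big_map /= -big_split mulr_sumr; apply: eq_bigr => x _ /=.
by rewrite !letter_power_parity mul1n mul0n expr0 mul1r mulrDl mul1r addrC.
Qed.

(** The condition compares two ring morphisms, so power sums suffice. Those of odd exponent take the
    same value on an even and an odd letter, as -(-y)^j = y^j, and those of even exponent are killed
    by D. *)
Lemma D_doubly_symmetric f : doubly_symmetric (D f).
Proof.
apply/doubly_symmetricP => k l u; move: (k + l)%N => n.
move: f; apply: power_sum_ind => [|a f g Ef Eg|f g Ef Eg|j].
- by rewrite D1 !hook_eval1.
- by rewrite linearP !linearD /= !hook_evalZ Ef Eg.
- by rewrite DM !hook_evalM Ef Eg.
rewrite D_power_sum !hook_evalZ !hook_eval_power_sum.
elim: n => [|n IH]; rewrite ?big_nil // !big_cons !mulrDr IH; congr (_ + _).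
rewrite !letter_power_parity mulrA [RHS]mulrA; congr (_ * _); rewrite mul0n mulr1.
case: (k <= n)%N; rewrite ?mulr1 // mul1n -signr_odd.
by case: odd; rewrite ?mulr1 // expr1 subrr mul0r.
Qed.

(** Conjugation switches the parity of every letter, which merely swaps the odd and the even copy of
    v. *)
Lemma D_schur_conj la : D (schur (conj_part la)) = D (schur la).
Proof.
apply: hook_eval_even_inj => v; rewrite !hook_eval_D hook_eval_schur_conj.
rewrite map_cat /monochrome -!map_comp; apply: hook_eval_perm.
by rewrite perm_catC.
Qed.

Lemma D_ideal f : in_ideal_gen schur_conj_diff f -> D f = 0.
Proof.
move=> [s Gs ->]; rewrite linear_sum big_seq big1 // => p /Gs[la ->].
by rewrite DM linearB /= D_schur_conj subrr mulr0.
Qed.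

Lemma D_decomposition g :
  exists a b, g = D a + b /\ in_ideal_gen schur_conj_diff b.
Proof.
move: g; apply: power_sum_ind =>
  [|c f g [a [b [-> Ib]]] [a' [b' [-> Ib']]]|f g [a [b [-> Ib]]] [a' [b' [-> Ib']]]|k].
- by exists 1, 0; rewrite D1 addr0; split=> //; apply: ideal_gen0.
- exists (c *: a + a'), (c *: b + b'); rewrite linearP scalerDr addrACA; split=> //.
  by apply: ideal_genD => //; apply: ideal_genZ.
(* In the expanded product every term other than D(a) D(a') = D(a a') contains b or b'. *)
- exists (a * a'), (D a * b' + (D a' + b') * b); split.
    by rewrite DM mulrDl mulrDr [b * _]mulrC addrA.
  by apply: ideal_genD; apply: ideal_genMl.
have [ok|ek] := boolP (odd k).
  by exists 0, (power_sum k); rewrite linear0 add0r; split=> //; apply: even_power_sum_ideal.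
exists (2%:R^-1 *: power_sum k), 0; split; last exact: ideal_gen0.
rewrite linearZ /= D_power_sum -signr_odd (negPf ek) expr0 scalerA.
by rewrite mulVf // scale1r addr0.
Qed.

Lemma D_inj f : doubly_symmetric f -> D f = 0 -> f = 0.
Proof.
move=> fd f0; apply: hook_eval_double_inj => v.
by rewrite -doubly_symmetric_double // -hook_eval_D f0 linear0.
Qed.

Lemma doubly_symmetricB f g :
  doubly_symmetric f -> doubly_symmetric g -> doubly_symmetric (f - g).
Proof.
move=> /doubly_symmetricP hf /doubly_symmetricP hg; apply/doubly_symmetricP => k l u.
by rewrite !linearB /= hf hg.
Qed.

Lemma D_surjective g : doubly_symmetric g -> exists f, D f = g.
Proof.
move=> gd; have [a [b [gE Ib]]] := D_decomposition g.
suff b0 : b = 0 by exists a; rewrite gE b0 addr0.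
apply: D_inj; last exact: D_ideal.
have -> : b = g - D a by rewrite gE addrC addKr.
exact/doubly_symmetricB/D_doubly_symmetric.
Qed.

Lemma D_kernel f : D f = 0 <-> in_ideal_gen schur_conj_diff f.
Proof.
split; last exact: D_ideal.
move=> f0; have [a [b [fE Ib]]] := D_decomposition f.
suff a0 : D a = 0 by rewrite fE a0 add0r.
apply: D_inj; first exact: D_doubly_symmetric.
by move: f0; rewrite fE linearD /= (D_ideal Ib) addr0.
Qed.
End MapD.

Theorem theorem3p6 :
  (exists D : {linear symfun -> symfun},
     forall la : intpart,
       D (schur la) =
       \sum_(mu <- subparts la) schur mu * skew_schur (conj_part la) (conj_part mu))
  /\
  (forall D : {linear symfun -> symfun},
     (forall la : intpart,
        D (schur la) =
        \sum_(mu <- subparts la)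
           schur mu * skew_schur (conj_part la) (conj_part mu)) ->
     [/\ forall f : symfun, doubly_symmetric (D f),
         forall g : symfun, doubly_symmetric g -> exists f : symfun, D f = g
       & forall f : symfun,
           D f = 0 <->
           in_ideal_gen
             (fun h : symfun =>
                exists la : intpart, h = schur la - schur (conj_part la)) f]).

Proof.
split=> [|D DE].
  exists (schur_ext (fun la => \sum_(mu <- subparts la)
    schur mu * skew_schur (conj_part la) (conj_part mu))) => la.
  exact: schur_extE.
split; [exact: D_doubly_symmetric | exact: D_surjective | exact: D_kernel].
Qed.
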